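(* Let $q$ be a prime power, let $n\ge 2$, and let $T$ be a uniformly random $F$-stable maximal torus of $GL_n(\overline{F_q})$. Then the expected value of the number of reducible dimension two subtori of $T$ minus the number of irreducible dimension two subtori of $T$, i.e. the expected value of $\binom{n_1(T)}{2}-n_2(T)$, is equal to $$\frac{1}{q}\,\frac{(1-1/q^{n-1})(1-1/q^n)}{(1-1/q)(1-1/q^2)}.$$
   Context: $F_q$ is the finite field with $q$ elements and $F$ denotes the Frobenius map on $GL_n(\overline{F_q})$ raising each matrix entry to the $q$-th power. The set of $F$-stable maximal tori $T$ (those with $F(T)=T$) is finite, and a random one is chosen uniformly from it. Each $F$-stable maximal torus $T$ has a type, a partition $\lambda$ of $n$: let $T_0$ be the diagonal torus and write $T=gT_0g^{-1}$ with $g\in GL_n(\overline{F_q})$; then $g^{-1}F(g)$ lies in the normalizer $N(T_0)$, its image in $N(T_0)/T_0\cong S_n$ is well defined up to conjugacy, and $\lambda$ is the cycle type of this conjugacy class. $n_i(T)$ denotes the number of parts of size $i$ of $\lambda$ (equivalently, the number of irreducible factors of $T$ over $F_q$ of dimension $i$). The number of reducible dimension two subtori of $T$ is $\binom{n_1(T)}{2}$ (pairs of distinct one-dimensional factors), and the number of irreducible dimension two subtori of $T$ is $n_2(T)$. *)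

(* Defs.v *)
From HB Require Import structures.
From mathcomp Require Import all_boot all_order all_fingroup all_algebra.
From mathcomp Require Import mpoly.
From mathcomp Require Import finmap boolp classical_sets cardinality.

Set Implicit Arguments.
Unset Strict Implicit.
Unset Printing Implicit Defensive.

Import GRing.Theory.

Local Open Scope classical_set_scope.
Local Open Scope ring_scope.

(** Linear algebraic groups are represented by their sets of points: subsets of
    ['M[K]_n] made of invertible matrices, with [K] algebraically closed. *)
Section AlgebraicGroups.

Variable K : closedFieldType.

(** The [n * n] variables are the matrix entries, in the order of [mxvec]. *)
Definition eval_entries (n : nat) (P : {mpoly K[n * n]}) (x : 'M[K]_n) : K :=
  P.@[fun i => mxvec x 0 i].

Definition closed_subgroup (n : nat) (G : set 'M[K]_n) : Prop :=
  [/\ forall x, G x -> x \in unitmx,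
      G 1%:M,
      forall x y, G x -> G y -> G (x *m y),
      forall x, G x -> G (invmx x) &
      exists S : set {mpoly K[n * n]},
        forall x, G x <->
          x \in unitmx /\ (forall P, S P -> eval_entries P x = 0)].

(** The coordinate ring of a closed subgroup of GL_n is the restriction of the
    coordinate ring of GL_n, which is generated by the entries and 1/det. *)
Definition regular_on (n : nat) (G : set 'M[K]_n) (f : 'M[K]_n -> K) : Prop :=
  exists (P : {mpoly K[n * n]}) (k : nat),
    forall x, G x -> f x = eval_entries P x / \det x ^+ k.

Definition alg_group_morphism (m n : nat) (G : set 'M[K]_m) (H : set 'M[K]_n)
    (f : 'M[K]_m -> 'M[K]_n) : Prop :=
  [/\ forall x, G x -> H (f x),
      forall x y, G x -> G y -> f (x *m y) = f x *m f y &
      forall i j, regular_on G (fun x => f x i j)].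

Definition alg_group_isomorphic (m n : nat)
    (G : set 'M[K]_m) (H : set 'M[K]_n) : Prop :=
  exists (f : 'M[K]_m -> 'M[K]_n) (g : 'M[K]_n -> 'M[K]_m),
    [/\ alg_group_morphism G H f, alg_group_morphism H G g,
        forall x, G x -> g (f x) = x & forall y, H y -> f (g y) = y].

Definition diag_torus (n : nat) : set 'M[K]_n :=
  [set x | x \in unitmx /\ is_diag_mx x].

Arguments diag_torus : clear implicits.

(** [diag_torus r] is the group G_m^r. *)
Definition torus (n : nat) (T : set 'M[K]_n) : Prop :=
  closed_subgroup T /\ exists r : nat, alg_group_isomorphic (diag_torus r) T.

Definition maximal_torus (n : nat) (T : set 'M[K]_n) : Prop :=
  torus T /\ forall T' : set 'M[K]_n, torus T' -> T `<=` T' -> T' = T.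

Definition conj_set (n : nat) (g : 'M[K]_n) (A : set 'M[K]_n) : set 'M[K]_n :=
  [set g *m x *m invmx g | x in A].

Definition frobenius (n q : nat) (x : 'M[K]_n) : 'M[K]_n :=
  map_mx (fun a : K => a ^+ q) x.

Definition stable_maximal_tori (q n : nat) : set (set 'M[K]_n) :=
  [set T | maximal_torus T /\ frobenius q @` T = T].

Definition cycle_type (n : nat) (s : 'S_n) : seq nat :=
  sort geq [seq #|pred_of_set c| | c <- enum (porbits s)].

(** The class of [w] in N(T_0)/T_0 corresponds to the permutation [s] for which
    [w] lies in the coset [perm_mx s * T_0]. *)
Definition has_type (q n : nat) (T : set 'M[K]_n) (lambda : seq nat) : Prop :=
  exists (g : 'M[K]_n) (s : 'S_n),
    [/\ g \in unitmx,
        T = conj_set g (diag_torus n),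
        exists2 d, diag_torus n d &
          invmx g *m frobenius q g = perm_mx s *m d &
        lambda = cycle_type s].

(** For a maximal torus stable under [frobenius q] exactly one partition
    satisfies [has_type]; the default value [[::]] is only reached on other
    sets. *)
Definition torus_type (q n : nat) (T : set 'M[K]_n) : seq nat :=
  xget [::] [set lambda | has_type q T lambda].

Definition n_parts (q n i : nat) (T : set 'M[K]_n) : nat :=
  count_mem i (torus_type q T).

(** Pairs of distinct one-dimensional irreducible factors of [T] over F_q. *)
Definition n_reducible_dim2 (q n : nat) (T : set 'M[K]_n) : nat :=
  'C(n_parts q 1 T, 2).

(** Two-dimensional irreducible factors of [T] over F_q. *)
Definition n_irreducible_dim2 (q n : nat) (T : set 'M[K]_n) : nat :=
  n_parts q 2 T.

End AlgebraicGroups.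

Arguments diag_torus K n : clear implicits.
Arguments stable_maximal_tori K q n : clear implicits.

(** Meaningful for finite nonempty [A]; otherwise the value is 0, since
    [fset_set] is empty on infinite sets. *)
Definition uniform_expectation (X : choiceType) (A : set X) (f : X -> rat) :
    rat :=
  (\sum_(x <- fset_set A) f x) / (#|` fset_set A|)%:R.

(* Main.v *)
Require Import Defs.
From HB Require Import structures.
From mathcomp Require Import all_boot all_order all_fingroup all_algebra.
From mathcomp Require Import finfield separable abelian mpoly.
From mathcomp Require Import finmap boolp classical_sets cardinality.
From mathcomp Require Import fintype finset ring.

Set Implicit Arguments.
Unset Strict Implicit.
Unset Printing Implicit Defensive.

Import GRing.Theory Num.Theory.

(** A maximal torus is a conjugate [g T_0 g^-1] of the diagonal torus, hence an
    unordered family of [n] independent lines, and it is stable when the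
    Frobenius map [F] permutes these lines.  The proof counts stable tori through
    their frames: matrices [g] with [F(g) = g P_s] for a permutation matrix
    [P_s].  The cycle type of [s] is the type of the torus ([torus_typeE]), and
    every stable torus has such a frame ([stable_maximal_torusP]), because the
    diagonal part of [g^-1 F(g)] can be absorbed into [g] ([hilbert90_perm]).

    For each [s] the frames form a torsor under the group [GL_n(F_q)], which is
    nonempty by [lang_perm_mx].  Two frames of one torus differ by a permutation
    and by a diagonal matrix that is fixed by a twisted Frobenius map; there are
    [\prod_c (q ^ |c| - 1)] such matrices, [c] ranging over the cycles of [s]
    ([seq_twisted_units]).  So, up to the common factor [|GL_n(F_q)| / n!], a sum
    over stable tori is a sum over the symmetric group with the weight
    [\prod_c 1 / (q ^ |c| - 1)] ([sum_stable_tori]), and the common factor cancels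
    in an expectation.

    What remains is a computation with permutations.  With
    [w_k = 1 / (q ^ k - 1)] one has [q ^ k w_k = 1 + w_k].  Multiplying the weight
    of a permutation of [n] points by [q ^ n] and expanding the product of the
    [1 + w_k] therefore gives a sum over the stable subsets, and the total weights
    [n! a_n] satisfy [q ^ n a_n = a_0 + ... + a_n] ([cycle_sum_rec]).  This
    determines [a_n] ([cycle_sumE]); it is Steinberg's theorem that there are
    [q ^ (n (n - 1))] stable maximal tori.  Finally [binom n_1 2 - n_2] counts the
    stable pairs of points, those fixed pointwise with sign [+1] and those that
    are exchanged with sign [-1].  Summing first over the permutation of the
    complement of the pair, the weighted sum is
    [binom n 2 (w_1 ^ 2 - w_2) (n - 2)! a_(n-2)] ([sum_pairs_cycle_weightE]), and
    the quotient by [n! a_n] is the announced value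
    ([mean_pairs_cycle_weight]).

    That maximal tori are conjugate to the diagonal one has an elementary proof
    here.  All elements of [K] are algebraic over [F_q], so an element of a torus
    satisfies [x ^ (q ^ k) = x] for some [k > 0]; this equation is separable,
    hence [x] is diagonalizable, and commuting diagonalizable matrices are
    diagonalizable simultaneously ([torus_sub_conj_diag]). *)

(** * Weights of permutations *)

Section CycleSums.

Local Open Scope ring_scope.

Variable T : finType.
Implicit Types (s t w : {perm T}) (A C c : {set T}) (x y : T).

Lemma astabs_perm s C x : s \in ('N(C | 'P))%g -> (s x \in C) = (x \in C).
Proof. by move=> sN; have := astabs_act x sN; rewrite /= apermE. Qed.

Lemma astabs_permP s C :
  (forall x, x \in C -> s x \in C) -> s \in ('N(C | 'P))%g.
Proof. by move=> sC; rewrite !inE; apply/subsetP => x xC; rewrite inE /= apermE sC. Qed.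

Lemma porbit_subset s C x :
  s \in ('N(C | 'P))%g -> (porbit s x \subset C) = (x \in C).
Proof.
move=> sN; apply/idP/idP => [/subsetP|xC]; first by apply; apply: porbit_id.
apply/subsetP => y /porbitP[i ->].
by rewrite astabs_perm // groupX.
Qed.

Lemma perm_on_astabs s A C : perm_on A s -> A \subset C -> s \in ('N(C | 'P))%g.
Proof.
move=> sA sAC; apply: astabs_permP => x xC; have [xA|xA] := boolP (x \in A).
  by apply: (subsetP sAC); rewrite perm_closed.
by rewrite (out_perm sA).
Qed.

Lemma eq_porbit_in s t C x :
  s \in ('N(C | 'P))%g -> {in C, s =1 t} -> x \in C -> porbit s x = porbit t x.
Proof.
move=> sN st xC; have stX i : (s ^+ i)%g x = (t ^+ i)%g x.
  elim: i => [|i IH]; first by rewrite !expg0.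
  by rewrite !expgSr !permM -IH st // astabs_perm // groupX.
apply/setP => y; apply/porbitP/porbitP => -[i ->]; exists i; by rewrite stX.
Qed.

Lemma porbits_conj s w :
  porbits (s ^ w)%g = (fun c : {set T} => w @: c) @: porbits s.
Proof.
have pE x : porbit (s ^ w)%g (w x) = w @: porbit s x.
  have wX i y : ((s ^ w) ^+ i)%g (w y) = w ((s ^+ i)%g y).
    by rewrite -conjXg conjgE !permM permK.
  apply/setP => y; apply/porbitP/imsetP => [[i ->]|[z /porbitP[i ->] ->]].
    by exists ((s ^+ i)%g x); rewrite ?mem_porbit.
  by exists i; rewrite wX.
apply/setP => c; apply/imsetP/imsetP => [[x _ ->]|[_ /imsetP[x _ ->] ->]].
  exists (porbit s ((w^-1)%g x)); first exact: imset_f.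
  by rewrite -pE permKV.
by exists (w x); rewrite ?pE.
Qed.

Lemma prod_porbits_conj s w (f : nat -> nat) :
  (\prod_(c in porbits (s ^ w)%g) f #|c| = \prod_(c in porbits s) f #|c|)%N.
Proof.
rewrite porbits_conj big_imset /=; last first.
  by move=> c c' _ _; apply: imset_inj; apply: perm_inj.
by apply: eq_bigr => c _; rewrite card_imset //; apply: perm_inj.
Qed.

Section Weights.
Variables (R : comNzRingType) (w : nat -> R).

Definition cycle_weight A s : R := \prod_(c in porbits s | c \subset A) w #|c|.

Definition cycle_sum A : R := \sum_(s | perm_on A s) cycle_weight A s.

Lemma eq_cycle_weight s t C :
    s \in ('N(C | 'P))%g -> t \in ('N(C | 'P))%g -> {in C, s =1 t} ->
  cycle_weight C s = cycle_weight C t.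
Proof.
move=> sN tN st; apply: eq_bigl => c.
apply/andP/andP => -[/imsetP[x _ ->]]; rewrite porbit_subset // => xC.
  by rewrite (eq_porbit_in sN st) // imset_f // porbit_subset.
have ts : {in C, t =1 s} by move=> y yC; rewrite st.
by rewrite (eq_porbit_in tN ts) // imset_f // porbit_subset.
Qed.

Lemma cycle_weightD s A C : s \in ('N(C | 'P))%g -> C \subset A ->
  cycle_weight A s = cycle_weight C s * cycle_weight (A :\: C) s.
Proof.
move=> sN sCA; rewrite /cycle_weight (bigID (fun c => c \subset C)) /=.
congr (_ * _); apply: eq_bigl => c; rewrite -andbA; apply: andb_id2l.
  by move=> _; apply/andb_idl => /subset_trans; apply.
move=> /imsetP[x _ ->{c}]; rewrite (porbit_subset _ sN) subsetD.
apply: andb_id2l => _; rewrite disjoint_sym; apply/idP/idP => [xC|].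
  rewrite disjoint_subset; apply/subsetP => y yC; apply: contra xC.
  by rewrite porbit_sym -(porbit_subset y sN) in yC * => /(subsetP yC).
rewrite disjoint_subset => /subsetP dC; apply/negP => xC.
by have := dC x xC; rewrite inE porbit_id.
Qed.

(** A permutation of [A] that stabilises [C] is a pair of permutations, one of
    [C] and one of [A :\: C]; a summand that splits accordingly gives a product
    of sums. *)
Lemma sum_astabs_split A C (G H : {perm T} -> R) :
    C \subset A ->
    (forall s t, perm_on C s -> perm_on (A :\: C) t -> G (s * t)%g = G s) ->
    (forall s t, perm_on C s -> perm_on (A :\: C) t -> H (s * t)%g = H t) ->
  \sum_(s | perm_on A s && (s \in ('N(C | 'P))%g)) G s * H s =
  (\sum_(s | perm_on C s) G s) * (\sum_(t | perm_on (A :\: C) t) H t).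
Proof.
move=> sCA GP HP; rewrite big_distrlr pair_big /=.
have splitP s t x : perm_on C s -> perm_on (A :\: C) t ->
    (s * t)%g x = if x \in C then s x else t x.
  move=> sC tD; rewrite permM; case: ifP => xC.
    by rewrite (out_perm tD) // inE perm_closed // xC.
  by rewrite (out_perm sC) // xC.
rewrite (reindex_onto (fun p : {perm T} * {perm T} => (p.1 * p.2)%g)
  (fun s => (restr_perm C s, restr_perm (A :\: C) s))) /=; last first.
  move=> s /andP[sA sN]; apply/permP => x.
  have sND : s \in ('N(A :\: C | 'P))%g.
    apply: astabs_permP => y; rewrite !inE astabs_perm // => /andP[-> yA].
    by rewrite perm_closed.
  rewrite splitP ?restr_perm_on //; case: ifP => xC; first by rewrite restr_permE.
  have [xD|xD] := boolP (x \in A :\: C); first by rewrite restr_permE.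
  rewrite (out_perm (restr_perm_on _ _)) // (out_perm sA) //.
  by move: xD; rewrite inE xC.
apply: eq_big => [[s t]|[s t] /andP[]] /=; last first.
  move=> _ /eqP[<- <-]; rewrite GP ?HP ?restr_perm_on //.
apply/idP/idP => [/andP[_ /eqP[<- <-]]|/andP[sC tD]]; first by rewrite !restr_perm_on.
have stN : (s * t)%g \in ('N(C | 'P))%g.
  by apply: astabs_permP => x xC; rewrite splitP // xC perm_closed.
have stND : (s * t)%g \in ('N(A :\: C | 'P))%g.
  apply: astabs_permP => x xD; rewrite splitP //.
  by move: (xD); rewrite inE => /andP[/negPf -> xA]; rewrite perm_closed.
have sA : perm_on A s := subset_trans sC sCA.
have tA : perm_on A t := subset_trans tD (subsetDl _ _).
rewrite stN andbT perm_onM //=.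
rewrite xpair_eqE; apply/andP; split; apply/eqP/permP => x.
  have [xC|xC] := boolP (x \in C).
    by rewrite restr_permE // splitP // xC.
  by rewrite !(out_perm _ xC) // restr_perm_on.
have [xD|xD] := boolP (x \in A :\: C).
  rewrite restr_permE // splitP //.
  by move: (xD); rewrite inE => /andP[/negPf -> xA].
by rewrite !(out_perm _ xD) // restr_perm_on.
Qed.

Lemma sum_card_porbits s A : s \in ('N(A | 'P))%g ->
  (\sum_(c in porbits s | c \subset A) #|c|)%N = #|A|.
Proof.
move=> sN; rewrite -[RHS]sum1_card (partition_big (porbit s)
  (fun c => (c \in porbits s) && (c \subset A))) /=; last first.
  by move=> x xA; rewrite imset_f // porbit_subset.
apply: eq_bigr => c /andP[/imsetP[x _ ->]]; rewrite porbit_subset // => xA.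
rewrite -sum1_card; apply: eq_bigl => y; rewrite eq_porbit_mem.
apply/esym/andb_idl => yx.
by apply: (subsetP _ y yx); rewrite porbit_subset.
Qed.

(** Expanding the product of the [1 + w k] over the cycles chooses a set of
    cycles, and a set of cycles is the same as a stable subset. *)
Lemma prod_1D_porbits s A : s \in ('N(A | 'P))%g ->
  \prod_(c in porbits s | c \subset A) (1 + w #|c|) =
  \sum_(C : {set T} | (C \subset A) && (s \in ('N(C | 'P))%g)) cycle_weight C s.
Proof.
move=> sN.
pose Q (c : {set T}) : pred bool := fun b => b ==> ((c \in porbits s) && (c \subset A)).
transitivity (\prod_(c : {set T}) \sum_(b | Q c b) (if b then w #|c| else 1)).
  rewrite big_mkcond; apply: eq_bigr => c _; rewrite /Q big_mkcond big_bool /=.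
  by case: ifP => _; rewrite ?add0r // addrC.
rewrite bigA_distr_big_dep.
pose h (C : {set T}) : {ffun {set T} -> bool} :=
  [ffun c : {set T} => (c \in porbits s) && (c \subset C)].
(* A choice of cycles and the union of the chosen cycles. *)
pose h' (g : {ffun {set T} -> bool}) : {set T} := [set x | g (porbit s x)].
have h'N g : s \in ('N(h' g | 'P))%g.
  by apply: astabs_permP => x; have := porbit_perm s 1 x; rewrite expg1 !inE => ->.
rewrite (reindex_onto h h') /=; last first.
  move=> g /familyP gQ; apply/ffunP => c; rewrite ffunE.
  have := gQ c; rewrite unfold_in; case: (boolP (c \in porbits s)) => //=; last first.
    by case: (g c).
  by move=> /imsetP[x _ ->] _; rewrite porbit_subset // inE.
apply: eq_big => [C|C _]; last first.
  rewrite /cycle_weight [RHS]big_mkcond; apply: eq_bigr => c _.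
  by rewrite ffunE.
apply/andP/andP => -[].
  move=> /familyP hC /eqP <-; split=> //; apply/subsetP => x.
  rewrite !inE ffunE => /andP[px sC].
  have := hC (porbit s x); rewrite unfold_in ffunE px sC /= => /subsetP; apply.
  exact: porbit_id.
move=> sCA sNC; split; last first.
  by apply/eqP/setP => x; rewrite inE ffunE imset_f // porbit_subset.
apply/familyP => c; rewrite unfold_in ffunE; apply/implyP => /andP[-> sc].
exact: subset_trans sCA.
Qed.

End Weights.

End CycleSums.

(** * Stable pairs of points *)

Section PairsOfFixedPoints.

Local Open Scope ring_scope.

Variable T : finType.
Implicit Types (s t : {perm T}) (A C c : {set T}) (x y : T).

Lemma porbit_fix s x : s x = x -> porbit s x = [set x].
Proof.
move=> sx; apply/setP => y; rewrite inE; apply/porbitP/eqP => [[i ->]|->].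
  by elim: i => [|i IH]; rewrite ?expg0 ?perm1 // expgSr permM IH.
by exists 0%N; rewrite expg0 perm1.
Qed.

Lemma card_porbit_eq1 s x : (#|porbit s x| == 1%N) = (s x == x).
Proof.
apply/cards1P/eqP => [[y py]|/porbit_fix ->]; last by exists x.
have := porbit_id s x; have := mem_porbit s 1 x.
by rewrite py expg1 !inE => /eqP -> /eqP ->.
Qed.

Definition n_cycles (k : nat) s : nat := #|[set c in porbits s | #|c| == k]|.

Lemma n_cycles1 s : n_cycles 1 s = #|[set x | s x == x]|.
Proof.
rewrite -(card_imset _ (@set1_inj T)); apply: eq_card => c; rewrite inE.
apply/andP/imsetP => [[/imsetP[x _ ->]]|[x]].
  rewrite card_porbit_eq1 => /eqP sx; exists x; rewrite ?inE ?sx //.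
  exact: porbit_fix.
by rewrite inE => /eqP sx ->; rewrite -(porbit_fix sx) imset_f // card_porbit_eq1 sx.
Qed.

Section Weighted.
Variables (R : comNzRingType) (w : nat -> R).

Lemma sum_bool_natr (I : finType) (P b : pred I) :
  \sum_(i | P i) (b i)%:R = #|[pred i | P i && b i]|%:R :> R.
Proof.
rewrite -natr_sum -sum1_card big_mkcondr; apply: congr1.
by apply: eq_bigr => i _; case: (b i).
Qed.

Definition pair_sign C s : R :=
  (C \subset [set x | s x == x])%:R - (C \in porbits s)%:R.

(** Both [binom n_1 2] and [n_2] count stable pairs of points: those fixed
    pointwise and those that are exchanged. *)
Lemma sum_pair_sign s :
  \sum_(C : {set T} | (#|C| == 2%N) && (s \in ('N(C | 'P))%g)) pair_sign C s =
  'C(n_cycles 1 s, 2)%:R - (n_cycles 2 s)%:R.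
Proof.
rewrite sumrB; congr (_ - _).
  rewrite sum_bool_natr n_cycles1 -cards_draws; congr _%:R.
  apply: eq_card => C; rewrite [LHS]inE [RHS]inE [RHS]andbC -andbA.
  apply: andb_id2l => _; apply/andb_idl => /subsetP sC; apply: astabs_permP => x xC.
  by have := sC x xC; rewrite inE => /eqP ->.
rewrite sum_bool_natr; congr _%:R.
apply: eq_card => C; rewrite [LHS]inE [RHS]inE [RHS]andbC -andbA.
apply: andb_id2l => _; apply/andb_idl => /imsetP[x _ ->]; apply: astabs_permP => y.
by have := porbit_perm s 1 y; rewrite expg1 -!eq_porbit_mem => ->.
Qed.

Lemma cycle_weight_porbit s x :
  cycle_weight w (porbit s x) s = w #|porbit s x|.
Proof.
rewrite /cycle_weight (big_pred1 (porbit s x)) // => c /=.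
apply/andP/eqP => [[/imsetP[y _ ->] /subsetP/(_ y (porbit_id s y))]|->].
  by rewrite -eq_porbit_mem => /eqP.
by rewrite imset_f.
Qed.

Lemma sum_perm_on_pair_sign C : #|C| = 2%N ->
  \sum_(s | perm_on C s) pair_sign C s * cycle_weight w C s =
  w 1%N ^+ 2 - w 2.
Proof.
move=> C2; move/eqP/cards2P: (C2) => [x [y [xy CE]]].
have -> : \sum_(s | perm_on C s) pair_sign C s * cycle_weight w C s =
    \sum_(s in [set 1%g; tperm x y]) pair_sign C s * cycle_weight w C s.
  have -> : [set 1%g; tperm x y] = [set s | perm_on C s].
    apply/eqP; rewrite eqEcard; apply/andP; split.
      apply/subsetP => s; rewrite !inE => /orP[]/eqP->; first exact: perm_on1.
      by rewrite CE; apply: tperm_on.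
    have -> : #|[set s | perm_on C s]| = 2 by rewrite cardsE card_perm C2.
    rewrite cards2; suff -> : (1%g : {perm T}) != tperm x y by [].
    by apply: contra xy => /eqP/permP/(_ x); rewrite tpermL perm1 => ->.
  by apply: eq_bigl => s; rewrite inE.
rewrite big_setU1 ?big_set1 /=; last first.
  rewrite inE; apply: contra xy => /eqP/permP/(_ x).
  by rewrite tpermL perm1 => ->.
have p1 z : porbit (1%g : {perm T}) z = [set z] := porbit_fix (perm1 z).
have pt : porbit (tperm x y) x = C.
  apply/eqP; rewrite eq_sym eqEcard; apply/andP; split.
    rewrite CE subUset !sub1set porbit_id /=.
    by have := mem_porbit (tperm x y) 1 x; rewrite expg1 tpermL.
  apply: subset_leq_card; rewrite porbit_subset; first by rewrite CE !inE eqxx.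
  by apply: perm_on_astabs (subxx _); rewrite CE tperm_on.
have -> : pair_sign C 1 = 1.
  rewrite /pair_sign; have -> : C \subset [set x | (1%g : {perm T}) x == x].
    by apply/subsetP => z _; rewrite inE perm1.
  case: imsetP => [[z _ Cz]|_]; last by rewrite subr0.
  by move: C2; rewrite Cz p1 cards1.
have -> : pair_sign C (tperm x y) = -1.
  rewrite /pair_sign -{2}pt imset_f //; case: subsetP => [/(_ x)|_].
    by rewrite CE !inE eqxx tpermL (eq_sym y) (negPf xy) => /(_ isT).
  by rewrite sub0r.
rewrite -pt cycle_weight_porbit pt C2 mulN1r mul1r; congr (_ - _).
rewrite (@cycle_weightD _ _ _ 1%g C [set x]); last 2 first.
- by apply: astabs_permP => z; rewrite perm1.
- by rewrite CE sub1set !inE eqxx.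
have -> : C :\: [set x] = [set y].
  by apply/setP => z; rewrite CE !inE; case: eqVneq => // ->; rewrite (negPf xy).
by rewrite -!p1 !cycle_weight_porbit !p1 !cards1.
Qed.

Lemma eq_pair_sign s t C : s \in ('N(C | 'P))%g -> t \in ('N(C | 'P))%g ->
  {in C, s =1 t} -> pair_sign C s = pair_sign C t.
Proof.
move=> sN tN st; rewrite /pair_sign; congr (_%:R - _%:R).
  congr nat_of_bool; apply/subsetP/subsetP => sC x xC; have := sC x xC;
  by rewrite !inE st.
have ts : {in C, t =1 s} by move=> y yC; rewrite st.
congr nat_of_bool; apply/imsetP/imsetP => -[x _ CE]; exists x => //.
  by rewrite -(eq_porbit_in sN st) // CE porbit_id.
by rewrite -(eq_porbit_in tN ts) // CE porbit_id.
Qed.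

(** A stable pair of points and the permutation induced on its complement
    determine everything but the choice between fixing and exchanging the two
    points. *)
Lemma sum_pairs_cycle_weight :
  \sum_(s : {perm T}) ('C(n_cycles 1 s, 2)%:R - (n_cycles 2 s)%:R) *
      cycle_weight w setT s =
  (w 1%N ^+ 2 - w 2) * \sum_(C : {set T} | #|C| == 2%N) cycle_sum w (~: C).
Proof.
under eq_bigr do rewrite -sum_pair_sign big_distrl /=.
rewrite (exchange_big_dep (fun C : {set T} => #|C| == 2%N)) /=; last first.
  by move=> s C _ /andP[].
rewrite big_distrr; apply: eq_bigr => C /eqP C2 /=.
rewrite -(sum_perm_on_pair_sign C2) -setTD -sum_astabs_split; first last.
- move=> s t sC tD; apply: eq_cycle_weight.
  + apply: astabs_permP => x xD; rewrite permM (out_perm sC) ?perm_closed //.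
    by move: xD; rewrite inE => /andP[].
  + exact: perm_on_astabs tD _.
  + by move=> x; rewrite inE => /andP[xC _]; rewrite permM (out_perm sC).
- move=> s t sC tD.
  have sN : s \in ('N(C | 'P))%g by exact: perm_on_astabs sC _.
  have st : {in C, (s * t)%g =1 s}.
    by move=> x xC; rewrite permM (out_perm tD) // inE perm_closed // xC.
  have stN : (s * t)%g \in ('N(C | 'P))%g.
    by apply: astabs_permP => x xC; rewrite st // perm_closed.
  by rewrite (eq_pair_sign stN sN st) (eq_cycle_weight _ stN sN st).
- exact: subsetT.
apply: eq_big => [s|s /andP[_ sN]].
  by rewrite C2 eqxx /=; apply/esym/andb_idl => _; apply/subsetP => x; rewrite inE.
by rewrite -mulrA -(cycle_weightD _ sN) ?subsetT.
Qed.

End Weighted.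

End PairsOfFixedPoints.

(** * The total weight of a symmetric group *)

Section ClosedForm.

Local Open Scope ring_scope.

Variables (F : fieldType) (x : F).
Hypothesis x_aperiodic : forall k, (0 < k)%N -> x ^+ k != 1.

Let w (k : nat) : F := (x ^+ k - 1)^-1.

(** For [x = q] this is [q ^ (n (n - 1)) / |GL_n(F_q)|]. *)
Definition steinberg_coef (n : nat) : F :=
  \prod_(i < n) (x ^+ i / (x ^+ i.+1 - 1)).

Lemma steinberg_coef_sum n :
  x ^+ n * steinberg_coef n = \sum_(m < n.+1) steinberg_coef m.
Proof.
elim: n => [|n IH]; first by rewrite big_ord1 expr0 mul1r.
have x1 : x ^+ n.+1 - 1 != 0 by rewrite subr_eq0 x_aperiodic.
have aS : steinberg_coef n.+1 * (x ^+ n.+1 - 1) = steinberg_coef n * x ^+ n.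
  by rewrite /steinberg_coef big_ord_recr /= -mulrA mulfVK.
rewrite big_ord_recr /= -IH; apply: (mulIf x1).
by rewrite mulrDl -!mulrA aS; ring.
Qed.

(** The identity [x ^ k * w k = 1 + w k] turns [x ^ #|A|] times the weight of a
    permutation of [A] into a product of the [1 + w k], which expands over the
    stable subsets [C]; the permutation of the complement of [C] is then free. *)
Lemma cycle_sum_rec (T : finType) (A : {set T}) :
  x ^+ #|A| * cycle_sum w A =
  \sum_(C : {set T} | C \subset A) cycle_sum w C * (#|A| - #|C|)`!%:R.
Proof.
rewrite /cycle_sum big_distrr /=.
have wE s : perm_on A s -> x ^+ #|A| * cycle_weight w A s =
  \sum_(C : {set T} | (C \subset A) && (s \in ('N(C | 'P))%g)) cycle_weight w C s.
  move=> sA; have sN := perm_on_astabs sA (subxx A).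
  rewrite -prod_1D_porbits // -(sum_card_porbits sN) -prodrXr -big_split /=.
  apply: eq_bigr => c /andP[/imsetP[y _ ->] _]; rewrite /w.
  have x1 : x ^+ #|porbit s y| - 1 != 0.
    by rewrite subr_eq0 x_aperiodic // lt0n card_porbit_neq0.
  by apply: (mulIf x1); rewrite mulrDl mul1r mulfVK // mulVf // subrK.
rewrite (eq_bigr _ wE) (exchange_big_dep (fun C : {set T} => C \subset A)) /=;
  last by move=> s C _ /andP[].
apply: eq_bigr => C sCA.
have -> : (#|A| - #|C|)`!%:R = \sum_(t | perm_on (A :\: C) t) (1%:R : F).
  by rewrite -natr_sum sum1_card card_perm cardsD (setIidPr sCA).
rewrite -sum_astabs_split //.
  by apply: eq_big => [s|s _]; rewrite ?sCA //; apply/esym/mulr1.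
move=> s t sC tD.
have sN : s \in ('N(C | 'P))%g by exact: perm_on_astabs sC _.
have st : {in C, (s * t)%g =1 s}.
  by move=> y yC; rewrite permM (out_perm tD) // inE perm_closed // yC.
have stN : (s * t)%g \in ('N(C | 'P))%g.
  by apply: astabs_permP => y yC; rewrite st // perm_closed.
exact: eq_cycle_weight.
Qed.

Lemma sum_subset_card (T : finType) (A : {set T}) (f : nat -> F) :
  \sum_(C : {set T} | C \subset A) f #|C| = \sum_(m < #|A|.+1) f m *+ 'C(#|A|, m).
Proof.
rewrite (partition_big (fun C : {set T} => inord #|C| : 'I_#|A|.+1) predT) //=.
apply: eq_bigr => m _; rewrite -cards_draws -sumr_const.
have Cm (C : {set T}) : C \subset A -> (inord #|C| == m) = (#|C| == m).
  by move=> CA; rewrite -val_eqE /= inordK // ltnS subset_leq_card.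
apply: eq_big => [C|C /andP[CA]].
  by rewrite inE; apply: andb_id2l; apply: Cm.
by rewrite Cm // => /eqP ->.
Qed.

(** Induction on the size of [A]: the recursion for the weighted sums becomes
    [steinberg_coef_sum] after division by the factorials. *)
Lemma cycle_sumE (T : finType) (A : {set T}) :
  cycle_sum w A = (#|A|)`!%:R * steinberg_coef #|A|.
Proof.
have [n] := ubnP #|A|; elim: n => // n IH in A *; rewrite ltnS => leAn.
case cA: #|A| => [|k].
  rewrite /steinberg_coef big_ord0 mulr1 fact0 /cycle_sum.
  move/eqP: cA; rewrite cards_eq0 => /eqP ->.
  rewrite (big_pred1 1%g) => [|s]; last first.
    apply/idP/eqP => [sA|->]; last exact: perm_on1.
    by apply/permP => y; rewrite (out_perm sA) ?inE ?perm1.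
  rewrite /cycle_weight big_pred0 // => c; apply/negP => /andP[/imsetP[y _ ->]].
  by rewrite subset0 => /eqP/setP/(_ y); rewrite porbit_id inE.
have x1 : x ^+ k.+1 - 1 != 0 by rewrite subr_eq0 x_aperiodic.
apply: (mulfI x1); rewrite mulrBl mul1r.
(* The term [C = A] of the recursion moves to the left-hand side. *)
have := cycle_sum_rec A; rewrite cA (bigD1 A) //= cA subnn fact0 mulr1 => ->.
rewrite addrC addrK mulrA [_ * k.+1`!%:R]mulrC -mulrA mulrBl mul1r.
rewrite steinberg_coef_sum big_ord_recr /= addrK.
transitivity (\sum_(C : {set T} | C \subset A)
   (if #|C| == k.+1 then 0 else (#|C|)`!%:R * steinberg_coef #|C| * (k.+1 - #|C|)`!%:R)).
  rewrite [RHS](bigD1 A) //= cA eqxx add0r; apply: eq_bigr => C /andP[CA CnA].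
  have ltC : (#|C| < k.+1)%N.
    by rewrite -cA ltn_neqAle subset_leq_card // andbT; apply: contra CnA => /eqP e;
       rewrite eqEcard CA e /=.
  by rewrite IH ?ltn_eqF // (leq_trans ltC) // -cA.
rewrite (sum_subset_card A (fun c => if c == k.+1 then 0 else
   c`!%:R * steinberg_coef c * (k.+1 - c)`!%:R)) cA big_ord_recr /= eqxx mul0rn addr0.
rewrite big_distrr; apply: eq_bigr => m _ /=.
rewrite ltn_eqF // -(bin_fact (ltnW (ltn_ord m))) !natrM -[LHS]mulr_natr.
by ring.
Qed.

Lemma sum_cycle_weight n :
  \sum_(s : 'S_n) cycle_weight w setT s = n`!%:R * steinberg_coef n.
Proof.
have := cycle_sumE [set: 'I_n]; rewrite cardsT card_ord => <-.
by apply: eq_bigl => s; apply/esym/subsetP => y; rewrite inE.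
Qed.

Lemma sum_pairs_cycle_weightE n : (1 < n)%N ->
  \sum_(s : 'S_n) ('C(n_cycles 1 s, 2)%:R - (n_cycles 2 s)%:R) *
     cycle_weight w setT s =
  (w 1 ^+ 2 - w 2) * ('C(n, 2) * (n - 2)`!)%:R * steinberg_coef (n - 2).
Proof.
move=> n2; rewrite sum_pairs_cycle_weight -!mulrA; congr (_ * _).
have cardT : #|[set: 'I_n]| = n by rewrite cardsT card_ord.
transitivity (\sum_(C in [set C : {set 'I_n} | C \subset setT & #|C| == 2%N])
   ((n - 2)`!%:R * steinberg_coef (n - 2))).
  apply: eq_big => [C|C /eqP C2]; first by rewrite inE subsetT.
  by rewrite cycle_sumE cardsCs setCK C2 card_ord.
by rewrite sumr_const cards_draws cardT natrM -mulrA [RHS]mulr_natl.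
Qed.

Lemma mean_pairs_cycle_weight n : (1 < n)%N -> n`!%:R != 0 :> F -> x != 0 ->
  (\sum_(s : 'S_n) ('C(n_cycles 1 s, 2)%:R - (n_cycles 2 s)%:R) *
     cycle_weight w setT s) / \sum_(s : 'S_n) cycle_weight w setT s =
  1 / x * (((1 - 1 / x ^+ (n - 1)) * (1 - 1 / x ^+ n)) /
     ((1 - 1 / x) * (1 - 1 / x ^+ 2))).
Proof.
move=> n2 nF x0; rewrite sum_pairs_cycle_weightE // sum_cycle_weight.
case: n n2 nF => [|[|m]] // _; rewrite subn2 subn1 /= -(@bin_fact m.+2 2) // subn2 /=.
rewrite !natrM !mulf_eq0 !negb_or => /and3P[C0 two0 m0].
have a0 k : steinberg_coef k != 0.
  apply/prodf_neq0 => i _; rewrite mulf_neq0 ?expf_neq0 // invr_neq0 //.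
  by rewrite subr_eq0 x_aperiodic.
have xk k : (0 < k)%N -> x ^+ k - 1 != 0 by move=> ?; rewrite subr_eq0 x_aperiodic.
have := xk m.+2 isT; have := xk m.+1 isT; have := xk 1%N isT; have := xk 2 isT.
rewrite {2}/steinberg_coef !big_ord_recr /= -/(steinberg_coef m) /w.
have := a0 m; have : x ^+ m != 0 by rewrite expf_neq0.
rewrite !exprSr expr0 !mul1r; set a := steinberg_coef m; set y := x ^+ m.
move: C0 two0 m0; set C := 'C(_, _)%:R; set f := m`!%:R => C0 two0 m0.
move=> y0 a_0 d2 d1 d3 d4.
case/and3P: two0 => two0 _ _.
by field; rewrite x0 d2 d1 y0 d4 d3 a_0 m0 two0.
Qed.

End ClosedForm.

(** * Functions equivariant along the cycles of a permutation *)

Section FunctionsAlongCycles.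

Variables (I : finType) (s : {perm I}).

Definition cycle_rep (i : I) : I := head i (enum (porbit s i)).

Lemma porbit_permE i : porbit s (s i) = porbit s i.
Proof. by have := porbit_perm s 1 i; rewrite expg1. Qed.

Lemma mem_cycle_rep i : cycle_rep i \in porbit s i.
Proof.
rewrite /cycle_rep -mem_enum; have := porbit_id s i; rewrite -mem_enum.
by case: (enum _) => //= a l _; apply: mem_head.
Qed.

Lemma porbit_cycle_rep i : porbit s (cycle_rep i) = porbit s i.
Proof. by apply/eqP; rewrite eq_porbit_mem mem_cycle_rep. Qed.

Lemma eq_cycle_rep i j : porbit s i = porbit s j -> cycle_rep i = cycle_rep j.
Proof.
rewrite /cycle_rep => ->; have := porbit_id s j; rewrite -mem_enum.
by case: (enum _).
Qed.

Section Transport.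

Variables (U : Type) (phi : I -> U -> U).

Fixpoint transport (i : I) (k : nat) (u : U) : U :=
  if k is k'.+1 then phi (iter k' s i) (transport i k' u) else u.

Lemma transportE (f : I -> U) : (forall i, f (s i) = phi i (f i)) ->
  forall i k, f (iter k s i) = transport i k (f i).
Proof. by move=> fs i; elim=> //= k <-; rewrite fs. Qed.

Lemma iter_cycle_rep i :
  exists2 k, (k < #|porbit s i|)%N & i = iter k s (cycle_rep i).
Proof.
have := porbit_traject s (cycle_rep i) i.
rewrite porbit_cycle_rep porbit_id => /esym/trajectP[k lk ki].
by exists k.
Qed.

Lemma cycle_solution_inj (f g : I -> U) :
    (forall i, f (s i) = phi i (f i)) -> (forall i, g (s i) = phi i (g i)) ->
  (forall i, f (cycle_rep i) = g (cycle_rep i)) -> f =1 g.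
Proof.
move=> fs gs fg i; have [k _ ->] := iter_cycle_rep i.
by rewrite !transportE // fg.
Qed.

(** A solution of [f (s i) = phi i (f i)] is freely given by one value on each
    cycle, subject to the condition that going once round the cycle returns to
    this value. *)
Lemma cycle_solution_exists (e : I -> U) :
    (forall i, transport i #|porbit s i| (e i) = e i) ->
  exists2 f : I -> U, forall i, f (s i) = phi i (f i) &
    forall i, f (cycle_rep i) = e (cycle_rep i).
Proof.
move=> e_closed.
pose j i := index i (traject s (cycle_rep i) #|porbit s i|).
have iter_j i : iter (j i) s (cycle_rep i) = i.
  have it : i \in traject s (cycle_rep i) #|porbit s i|.
    by rewrite -(porbit_cycle_rep i) -porbit_traject porbit_cycle_rep porbit_id.
  rewrite -(@nth_traject _ s (j i) #|porbit s i|) ?nth_index //.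
  by move: it; rewrite -index_mem size_traject.
have jE i k : (k < #|porbit s i|)%N -> j (iter k s (cycle_rep i)) = k.
  move=> lk; have pi : porbit s (iter k s (cycle_rep i)) = porbit s i.
    by rewrite -permX porbit_perm porbit_cycle_rep.
  rewrite /j pi (eq_cycle_rep pi) -(nth_traject s lk) index_uniq ?size_traject //.
  by rewrite -(porbit_cycle_rep i) uniq_traject_porbit.
have j_rep i : j (cycle_rep i) = 0%N.
  by rewrite -[X in j X]/(iter 0 s (cycle_rep i)) jE // lt0n card_porbit_neq0.
exists (fun i => transport (cycle_rep i) (j i) (e (cycle_rep i))) => i; last first.
  by rewrite j_rep /= (eq_cycle_rep (porbit_cycle_rep i)).
have ji : (j i < #|porbit s i|)%N.
  rewrite /j -[X in (_ < X)%N](size_traject s (cycle_rep i)) index_mem.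
  by rewrite -(porbit_cycle_rep i) -porbit_traject porbit_cycle_rep porbit_id.
rewrite (eq_cycle_rep (porbit_permE i)).
have siE : s i = iter (j i).+1 s (cycle_rep i) by rewrite iterS iter_j.
have phiE : phi i (transport (cycle_rep i) (j i) (e (cycle_rep i))) =
    transport (cycle_rep i) (j i).+1 (e (cycle_rep i)) by rewrite /= iter_j.
rewrite phiE; move: ji; rewrite leq_eqVlt => /orP[/eqP ji|ji].
  have -> : j (s i) = 0%N.
    rewrite siE ji -(porbit_cycle_rep i) iter_porbit.
    exact: j_rep.
  by rewrite ji -(porbit_cycle_rep i) e_closed.
by rewrite siE jE.
Qed.

End Transport.

Lemma transport_cst (U : Type) (phi : U -> U) i k u :
  transport (fun=> phi) i k u = iter k phi u.
Proof. by elim: k => //= k ->. Qed.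

(** Restriction to the chosen representatives identifies the solutions with the
    families that attach to each cycle [c] a point fixed by the power [#|c|] of
    [phi]. *)
Lemma card_equivariant (U : finType) (u0 : U) (phi : U -> U) (A : {pred U}) :
    (forall u, u \in A -> phi u \in A) ->
  #|[set f : {ffun I -> U} | [forall i, (f i \in A) && (f (s i) == phi (f i))]]| =
  \prod_(c in porbits s) #|[pred u in A | iter #|c| phi u == u]|.
Proof.
move=> phiA; set S := [set f | _].
pose E (f : {ffun I -> U}) : {ffun {set I} -> U} :=
  [ffun c => if [pick i | porbit s i == c] is Some i then f (cycle_rep i) else u0].
have EE f i : E f (porbit s i) = f (cycle_rep i).
  rewrite ffunE; case: pickP => [k /eqP /eq_cycle_rep -> //|/(_ i)].
  by rewrite eqxx.
have SP (f : {ffun I -> U}) : reflect ((forall i, f i \in A) /\ forall i, f (s i) = phi (f i)) (f \in S).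
  rewrite inE; apply: (iffP forallP) => [fP|[fA fs] i]; last by rewrite fA fs eqxx.
  by split=> i; have /andP[? /eqP] := fP i.
have E_inj : {in S &, injective E}.
  move=> f g /SP[_ fs] /SP[_ gs] Efg; apply/ffunP.
  apply: (cycle_solution_inj (phi := fun=> phi)) => // i.
  by rewrite -!EE Efg.
rewrite -(card_in_imset E_inj).
pose F (c : {set I}) := [pred u in A | iter #|c| phi u == u].
have -> : #|[set E x | x in S]| = #|pfamily u0 (mem (porbits s)) F|.
  apply: eq_card => g; apply/imsetP/pfamilyP => [[f /SP[fA fs] ->]|[gsupp gF]].
    split=> [|c /imsetP[i _ ->]].
      apply/subsetP => c; rewrite unfold_in ffunE; case: pickP => [i /eqP <-|_].
        by rewrite /= imset_f.
      by rewrite eqxx.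
    rewrite EE inE fA /= -(transport_cst _ (cycle_rep i)) -transportE //.
    by rewrite -{1}(porbit_cycle_rep i) iter_porbit eqxx.
  have gFi i : (g (porbit s i) \in A) /\
      iter #|porbit s i| phi (g (porbit s i)) = g (porbit s i).
    by have := gF (porbit s i) (imset_f _ isT); rewrite inE => /andP[? /eqP].
  have [|f fs fE] := @cycle_solution_exists U (fun=> phi) (fun i => g (porbit s i)).
    by move=> i; rewrite transport_cst; case: (gFi i).
  have fA i : f i \in A.
    have [k _ ->] := iter_cycle_rep i.
    elim: k => [|k IH]; first by rewrite fE porbit_cycle_rep; case: (gFi i).
    by rewrite iterS fs phiA.
  exists [ffun i => f i]; first by apply/SP; split=> i; rewrite !ffunE.
  apply/ffunP => c; rewrite ffunE; case: pickP => [i /eqP <-|nc].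
    by rewrite ffunE fE porbit_cycle_rep.
  apply/eqP; apply: contraT => gc; have /imsetP[i _ ci] := subsetP gsupp c gc.
  by have := nc i; rewrite ci eqxx.
by rewrite card_pfamily foldrE big_map big_enum.
Qed.

End FunctionsAlongCycles.

(** * The Frobenius map on an algebraic closure of a finite field *)

Section FrobeniusOnTheClosure.

Local Open Scope ring_scope.

Variables (Fq : finFieldType) (K : closedFieldType) (iota : {rmorphism Fq -> K}).

Local Notation q := #|Fq|.

(** Naming [iota] in the term lets its ring morphism structure be inferred:
    additivity holds because [q] is a power of the characteristic. *)
Definition frob of {rmorphism Fq -> K} := fun a : K => a ^+ q.

Local Notation F := (frob iota).

Lemma card_field_pchar_nat : [pchar K].-nat q.
Proof.
have [p p_pr pFq] := finPcharP Fq.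
have pK : p \in [pchar K] by rewrite (rmorph_pchar iota).
rewrite (eq_pnat _ (pcharf_eq pK)) (card_pprimeChar pFq) pnatX orbC.
by rewrite pnat_id // orbT.
Qed.

Lemma natr_card_field : q%:R = 0 :> K.
Proof.
have [p p_pr pFq] := finPcharP Fq.
have pK : p \in [pchar K] by rewrite (rmorph_pchar iota).
have := finNzRing_gt1 Fq; rewrite (card_pprimeChar pFq) natrX (pcharf0 pK) expr0n.
by case: (logn _ _).
Qed.

Fact frob_is_zmod_morphism : zmod_morphism F.
Proof.
move=> a b; rewrite /frob -{2}(subrK b a) (@exprDn_pchar _ (a - b)) ?addrK //.
exact: card_field_pchar_nat.
Qed.

Fact frob_is_monoid_morphism : monoid_morphism F.
Proof. by split=> [|a b]; rewrite /frob ?expr1n ?exprMn. Qed.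

HB.instance Definition _ :=
  GRing.isZmodMorphism.Build K K F frob_is_zmod_morphism.
HB.instance Definition _ :=
  GRing.isMonoidMorphism.Build K K F frob_is_monoid_morphism.

Lemma frob_iter k a : iter k F a = a ^+ (q ^ k).
Proof. by elim: k => [|k IH] //=; rewrite IH /frob -exprM expnSr. Qed.

Lemma frob_periodic_dvd (a : K) k N : a ^+ (q ^ k) = a -> (k %| N)%N -> a ^+ (q ^ N) = a.
Proof.
move=> ak /dvdnP[l ->]; rewrite -frob_iter.
elim: l => [|l IH]; first by rewrite mul0n.
by rewrite mulSn iterD IH frob_iter ak.
Qed.

Lemma frob_iota b : F (iota b) = iota b.
Proof. by rewrite /frob -rmorphXn expf_card. Qed.

Lemma frob_fixed a : F a = a -> exists b, a = iota b.
Proof.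
move=> Fa; have : root (map_poly iota ('X^q - 'X)) a.
  by rewrite rmorphB /= map_polyXn map_polyX rootE !hornerE -/(F a) Fa subrr.
rewrite finField_genPoly rmorph_prod /= (eq_bigr (fun x => 'X - (iota x)%:P)); last first.
  by move=> x _; rewrite rmorphB /= map_polyX map_polyC.
rewrite -(big_map iota predT (fun z => 'X - z%:P)) root_prod_XsubC.
by case/mapP => b _ ->; exists b.
Qed.

(** The derivative of ['X^(q ^ k) - 'X] is [-1], so its roots are simple. *)
Lemma frob_iter_poly k : (0 < k)%N ->
  exists2 rs : seq K, uniq rs & 'X^(q ^ k) - 'X = \prod_(z <- rs) ('X - z%:P).
Proof.
move=> k0; set N := (q ^ k)%N; pose P : {poly K} := 'X^N - 'X.
have N1 : (1 < N)%N by rewrite -(exp1n k) ltn_exp2r // finNzRing_gt1.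
have sX : (size (- 'X : {poly K})%R < size ('X^N : {poly K})%R)%N.
  by rewrite size_polyN size_polyX size_polyXn ltnS.
have [rs PE] := closed_field_poly_normal P.
have lP : lead_coef P = 1 by rewrite lead_coefDl // lead_coefXn.
rewrite lP scale1r in PE.
have NK : N%:R = 0 :> K by rewrite /N natrX natr_card_field expr0n (gtn_eqF k0).
exists rs => //; rewrite -separable_prod_XsubC -PE unlock /separable_poly.
have -> : P^`() = - 1.
  by rewrite derivB derivXn derivX -mulr_natl -polyC_natr NK mul0r sub0r.
by rewrite -scaleN1r coprimepZr ?oppr_eq0 ?oner_eq0 // coprimep1.
Qed.

(** The subfield of [K] with [q ^ k] elements. *)
Lemma roots_frob_iter k : (0 < k)%N ->
  exists2 rs : seq K, uniq rs /\ size rs = (q ^ k)%N &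
    forall a, (a \in rs) = (a ^+ (q ^ k) == a).
Proof.
move=> k0; have [rs urs rsE] := frob_iter_poly k0.
have N1 : (1 < q ^ k)%N by rewrite -(exp1n k) ltn_exp2r // finNzRing_gt1.
exists rs; first split=> //.
  have : size ('X^(q ^ k) - 'X : {poly K}) = (q ^ k).+1.
    by rewrite size_polyDl size_polyXn // size_polyN size_polyX ltnS.
  by rewrite rsE size_prod_XsubC => -[].
by move=> a; rewrite -root_prod_XsubC -rsE rootE !hornerE subr_eq0.
Qed.

Lemma exists_neq01 : exists2 a : K, a != 0 & a != 1.
Proof.
have [rs [urs srs] _] := @roots_frob_iter 2 isT.
suff /allPn[a _] : ~~ all (mem [:: 0; 1 : K]) rs.
  by rewrite !inE negb_or => /andP[]; exists a.
apply/negP => /allP /(uniq_leq_size urs); rewrite srs /= leqNgt => /negP; apply.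
by rewrite (@leq_trans (2 ^ 2)) // leq_exp2r // finNzRing_gt1.
Qed.

(** The powers [a ^ (q ^ i)] are values at [a] of polynomials over [Fq] of bounded
    size, so two of them coincide; as the Frobenius map is injective, the sequence
    is periodic from its first term. *)
Lemma integral_frob_periodic : integralRange iota ->
  forall a : K, exists2 k, (0 < k)%N & a ^+ (q ^ k) = a.
Proof.
move=> algK a; have [p p_monic pa] := algK a.
pose d := size p; pose N := #|{: 'rV[Fq]_d}|.
have val i : {t : 'rV[Fq]_d | a ^+ (q ^ i) = (map_poly iota (rVpoly t)).[a]}.
  exists (poly_rV ('X^(q ^ i) %% p)).
  rewrite poly_rV_K; last by rewrite ltnW // ltn_modp monic_neq0.
  have := congr1 (fun r => (map_poly iota r).[a]) (divp_eq 'X^(q ^ i) p).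
  rewrite map_polyXn hornerXn rmorphD rmorphM /= hornerD hornerM.
  by rewrite (rootP pa) mulr0 add0r.
pose v (i : 'I_N.+1) := sval (val i).
have /injectivePn[i [j ij vij]] : ~~ injectiveb v.
  apply/injectiveP => /leq_card; rewrite card_ord; apply/negP.
  by rewrite -ltnNge.
have aij : a ^+ (q ^ i) = a ^+ (q ^ j).
  by rewrite (svalP (val i)) (svalP (val j)) -/(v i) -/(v j) vij.
wlog lij : i j ij {vij} aij / (i < j)%N.
  move=> wl; have := ij; rewrite neq_ltn => /orP[|] l; first exact: (wl i j).
  by apply: (wl j i) => //; rewrite eq_sym.
exists (j - i)%N; first by rewrite subn_gt0.
have Finj k : injective (iter k F).
  by elim: k => [|k IH] x y //= /(fmorph_inj F) /IH.
apply: (Finj i); rewrite -frob_iter -iterD subnKC ?(ltnW lij) // !frob_iter.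
exact: esym.
Qed.

End FrobeniusOnTheClosure.

(** * Frobenius equations twisted by a permutation *)

Section TwistedEquations.

Local Open Scope ring_scope.

(** Choose a free family of maximal size.  It replaces the possibly infinite set [P]
    by the rows of a matrix. *)
Lemma exists_row_free_span (F : fieldType) (m : nat) (P : 'rV[F]_m -> Prop) :
  exists (r : nat) (g : 'M[F]_(r, m)),
    [/\ row_free g, forall i, P (row i g) & forall v, P v -> (v <= g)%MS].
Proof.
suff H k : (exists (r : nat) (g : 'M[F]_(r, m)),
    [/\ row_free g, forall i, P (row i g) & forall v, P v -> (v <= g)%MS]) \/
    exists g : 'M[F]_(k, m), row_free g /\ forall i, P (row i g).
  have [//|[g [gf _]]] := H m.+1.
  by have := rank_leq_col g; rewrite (eqP gf) ltnn.
elim: k => [|k [IH|[g [gf gP]]]]; [right|by left|].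
  exists 0; split; last by case.
  by rewrite /row_free mxrank0.
have [gspan|] := pselect (forall v, P v -> (v <= g)%MS); first by left; exists k, g.
move=> /existsNP[v /not_implyP[Pv /negP vg]]; right.
exists (col_mx v g : 'M_(1 + k, m)); split.
  rewrite /row_free eqn_leq rank_leq_row /=.
  have -> : \rank (col_mx v g) = \rank (g + v)%MS by rewrite addsmxC addsmxE.
  have [_] := mxrank_leqif_sup (addsmxSl g v).
  rewrite addsmx_sub submx_refl (negPf vg) /= => /negbT ne.
  rewrite -[X in (X < _)%N](eqP gf) ltn_neqAle ne /=.
  by apply: mxrankS; apply: addsmxSl.
suff cP (i : 'I_(1 + k)) : P (row i (col_mx v g)) by exact: cP.
case: (split_ordP i) => j ->; last by rewrite rowKd.
by rewrite rowKu ord1 row_id.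
Qed.

Variables (Fq : finFieldType) (K : closedFieldType) (iota : {rmorphism Fq -> K}).

Local Notation q := #|Fq|.
Local Notation F := (frob iota).

Lemma seq_twisted_solutions (n : nat) (s : 'S_n) (A : pred K) (card_A : nat -> nat) :
    (forall a, A a -> A (F a)) ->
    (forall k, (0 < k)%N -> exists2 rs : seq K, uniq rs /\ size rs = card_A k &
       forall a, (a \in rs) = A a && (a ^+ (q ^ k) == a)) ->
  exists2 S : seq {ffun 'I_n -> K},
    uniq S /\ size S = (\prod_(c in porbits s) card_A #|c|)%N &
    forall f, f \in S <-> forall i, A (f i) /\ f (s i) = F (f i).
Proof.
move=> AF Acard.
(* The cycles have lengths dividing [n!], so that all the solutions take values
   in the finite field with [q ^ n!] elements. *)
have [rs [urs _] rsE] := roots_frob_iter iota (fact_gt0 n).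
pose U := seq_sub rs.
have Frs (u : U) : F (val u) \in rs.
  have := valP u; rewrite !rsE => /eqP ue.
  by rewrite -(frob_iter iota) -iterSr iterS frob_iter ue.
pose phi (u : U) : U := SeqSub (Frs u).
have phi_iter k (u : U) : val (iter k phi u) = val u ^+ (q ^ k).
  by rewrite -(frob_iter iota); elim: k => //= k <-.
have in_rs k a : (0 < k <= n)%N -> a ^+ (q ^ k) = a -> a \in rs.
  by move=> kn ak; rewrite rsE (frob_periodic_dvd iota ak) ?dvdn_fact.
have u0 : U.
  by exists 0; rewrite rsE expr0n expn_eq0 eqn0Ngt (ltnW (finNzRing_gt1 Fq)).
pose B : {pred U} := [pred u | A (val u)].
pose X := [set f : {ffun 'I_n -> U} | [forall i, (f i \in B) && (f (s i) == phi (f i))]].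
pose v (f : {ffun 'I_n -> U}) : {ffun 'I_n -> K} := [ffun i => val (f i)].
have v_inj : injective v.
  by move=> f g /ffunP fg; apply/ffunP => i; apply: val_inj; have := fg i; rewrite !ffunE.
exists [seq v f | f <- enum X]; first split.
- by rewrite (map_inj_uniq v_inj) enum_uniq.
- rewrite size_map -cardE (card_equivariant s u0); last first.
    by move=> u; apply: AF.
  apply: eq_bigr => c /imsetP[i _ ->].
  have c0 : (0 < #|porbit s i|)%N by rewrite lt0n card_porbit_neq0.
  have cn : (#|porbit s i| <= n)%N by rewrite -[leqRHS](card_ord n) max_card.
  have [rk [urk <-] rkE] := Acard _ c0.
  set W := [pred u in _ | _].
  have -> : #|W| = size [seq val u | u : U <- enum W] by rewrite size_map -cardE.
  apply/perm_size/uniq_perm => //.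
    by rewrite (map_inj_uniq val_inj) enum_uniq.
  move=> a; rewrite rkE; apply/mapP/andP => [[u]|[Aa /eqP ak]].
    rewrite mem_enum !inE -val_eqE /= phi_iter => /andP[Au uk] ->.
    by rewrite uk.
  have ars : a \in rs by apply: in_rs ak; rewrite c0.
  exists (SeqSub ars) => //.
  by rewrite mem_enum !inE -val_eqE /= phi_iter /= ak eqxx andbT.
move=> f; split=> [/mapP[g]|fs].
  rewrite mem_enum inE => /forallP gP -> i; have /andP[gA /eqP gs] := gP i.
  by rewrite !ffunE gs.
have frs i : f i \in rs.
  apply: (@in_rs #|porbit s i|).
    by rewrite lt0n card_porbit_neq0 -[leqRHS](card_ord n) max_card.
  rewrite -(frob_iter iota) -(transport_cst s F i).
  by rewrite -transportE ?iter_porbit // => j; case: (fs j).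
apply/mapP; exists [ffun i => SeqSub (frs i)]; last by apply/ffunP => i; rewrite !ffunE.
rewrite mem_enum inE; apply/forallP => i; rewrite !ffunE; have [fA fsi] := fs i.
by rewrite unfold_in fA -val_eqE /= fsi.
Qed.

Lemma porbits_sum_card n (s : 'S_n) : (\sum_(c in porbits s) #|c|)%N = n.
Proof.
have sN : s \in ('N(setT | 'P))%g by apply: astabs_permP => x; rewrite !inE.
rewrite -[RHS]card_ord -cardsT -(sum_card_porbits sN).
by apply: eq_bigl => c; rewrite subsetT andbT.
Qed.

Lemma seq_twisted_vectors n (s : 'S_n) :
  exists2 S : seq {ffun 'I_n -> K}, uniq S /\ size S = (q ^ n)%N &
    forall f, f \in S <-> forall i, f (s i) = F (f i).
Proof.
have [//||S [uS sS] SE] := @seq_twisted_solutions n s predT (fun k => (q ^ k)%N).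
  by move=> k /(roots_frob_iter iota)[rs ? rsE]; exists rs.
exists S; first by rewrite sS -expn_sum porbits_sum_card.
by move=> f; rewrite SE; split=> fs i; [case: (fs i) | split].
Qed.

Lemma seq_twisted_units n (s : 'S_n) :
  exists2 S : seq {ffun 'I_n -> K},
    uniq S /\ size S = (\prod_(c in porbits s) (q ^ #|c| - 1))%N &
    forall f, f \in S <-> forall i, f i != 0 /\ f (s i) = F (f i).
Proof.
apply: (@seq_twisted_solutions n s (fun a => a != 0) (fun k => (q ^ k - 1)%N)).
  by move=> a; rewrite fmorph_eq0.
move=> k /(roots_frob_iter iota)[rs [urs srs] rsE]; exists (rem 0 rs).
  rewrite rem_uniq // size_rem ?srs ?subn1 // rsE expr0n expn_eq0.
  by rewrite eqn0Ngt (ltnW (finNzRing_gt1 Fq)).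
by move=> a; rewrite (mem_rem_uniq _ urs) inE rsE.
Qed.

Lemma frob_mx_fixed m n (A : 'M[K]_(m, n)) : map_mx F A = A ->
  exists B : 'M[Fq]_(m, n), A = map_mx iota B.
Proof.
move=> /matrixP FA.
have AP i j : exists b, A i j = iota b.
  by apply: (@frob_fixed _ _ iota); have := FA i j; rewrite mxE.
have [b bE] := choice (fun p : 'I_m * 'I_n => AP p.1 p.2).
by exists (\matrix_(i, j) b (i, j)); apply/matrixP => i j; rewrite !mxE -bE.
Qed.

(** The [q ^ n] solutions of [F v = v *m perm_mx s] form a space over [Fq].  In
    a maximal family of solutions that is free over [K], the other solutions
    have coordinates fixed by [F], hence in [Fq]; counting shows that the family
    has [n] members. *)
Lemma lang_perm_mx n (s : 'S_n) : exists2 g : 'M[K]_n, g \in unitmx &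
  map_mx F g = g *m perm_mx s.
Proof.
have [S [uS sS] SE] := seq_twisted_vectors s^-1%g.
pose P (v : 'rV[K]_n) := map_mx F v = v *m perm_mx s.
have PE (v : 'rV[K]_n) : P v <-> forall i, v 0 ((s^-1)%g i) = F (v 0 i).
  rewrite /P -[s in perm_mx s]invgK -col_permE; split=> [/rowP vP i|vP].
    by have := vP i; rewrite !mxE.
  by apply/rowP => i; rewrite !mxE vP.
have [r [g [g_free gP g_span]]] := exists_row_free_span P.
have gF : map_mx F g = g *m perm_mx s.
  by apply/row_matrixP => i; rewrite row_mul -gP map_row.
pose co (f : {ffun 'I_n -> K}) := \row_i f i *m pinvmx g.
have coP f : f \in S -> P (\row_i f i).
  by move/SE => fP; apply/PE => i; rewrite !mxE fP.
have coK f : f \in S -> co f *m g = \row_i f i.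
  by move=> /coP Pf; rewrite /co mulmxKpV // g_span.
have coF f : f \in S -> map_mx F (co f) = co f.
  move=> fS; apply: (row_free_inj g_free); apply: (can_inj (mulmxK (unitmx_perm K s))).
  rewrite -[LHS]mulmxA -gF -map_mxM coK //.
  by rewrite (coP f fS) -coK.
have coV f : exists x : 'rV[Fq]_r, f \in S -> co f = map_mx iota x.
  have [fS|_] := boolP (f \in S); last by exists 0.
  by have [x xE] := frob_mx_fixed (coF f fS); exists x.
have [x xE] := choice coV.
have x_inj : {in S &, injective x}.
  move=> f f' fS f'S xx; have : \row_i f i = \row_i f' i.
    by rewrite -!coK // !xE // xx.
  by move=> /rowP ff; apply/ffunP => i; have := ff i; rewrite !mxE.
have nr : (n <= r)%N.
  rewrite -(leq_exp2l _ _ (finNzRing_gt1 Fq)) -sS -(size_map x).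
  have := card_mx Fq 1 r; rewrite mul1n => <-.
  have /card_uniqP <- : uniq [seq x f | f <- S] by rewrite map_inj_in_uniq.
  exact: max_card.
have rn : r = n by apply/eqP; rewrite eqn_leq nr andbT -(eqP g_free) rank_leq_col.
subst r; exists g => //; by rewrite -row_free_unit.
Qed.

(** Along a cycle of length [k], one value [u] determines the others, and the cycle
    closes up when [c * u ^ (q ^ k) = u] for a certain nonzero [c]; this equation
    has a nonzero root in [K]. *)
Lemma hilbert90_perm n (s : 'S_n) (d : 'I_n -> K) : (forall i, d i != 0) ->
  exists2 t : 'I_n -> K, forall i, t i != 0 & forall i, t (s i) = d i * F (t i).
Proof.
move=> d0; pose phi i u := d i * F u.
have phiC i k : exists2 c, c != 0 & forall u, transport s phi i k u = c * u ^+ (q ^ k).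
  elim: k => [|k [c c0 cE]]; first by exists 1 => [|u]; rewrite ?oner_neq0 //= mul1r.
  exists (d (iter k s i) * F c) => [|u]; first by rewrite mulf_neq0 // fmorph_eq0.
  by rewrite /= /phi cE rmorphM mulrA -!(frob_iter iota).
have eP i : exists u, u != 0 /\ transport s phi i #|porbit s i| u = u.
  have [c c0 cE] := phiC i #|porbit s i|.
  set k := #|_| in cE *; pose N := (q ^ k)%N.
  have N1 : (1 < N)%N.
    rewrite -(exp1n k) ltn_exp2r ?finNzRing_gt1 // lt0n; exact: card_porbit_neq0.
  have N0 : (0 < N.-1)%N by rewrite -ltnS prednK // ltnW.
  have [u uE] := @solve_monicpoly K N.-1 (fun i => if i == 0%N then c^-1 else 0) N0.
  have {}uE : u ^+ N.-1 = c^-1.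
    rewrite uE (bigD1 (Ordinal N0)) //= big1 ?addr0 ?mulr1 // => j.
    by rewrite -val_eqE /= => /negPf ->; rewrite mul0r.
  exists u; split; last first.
    by rewrite cE -/N -(prednK (ltnW N1)) exprSr mulrA uE divff // mul1r.
  apply/eqP => u0; move: uE; rewrite u0 expr0n (gtn_eqF N0) => /esym/eqP.
  by rewrite invr_eq0 (negPf c0).
have [e eE] := choice eP.
have [|t tE te] := @cycle_solution_exists _ s K phi e.
  by move=> i; case: (eE i).
exists t => // i; have [k _ ->] := iter_cycle_rep s i.
elim: k => [|k IH] /=; first by rewrite te; case: (eE (cycle_rep s i)).
by rewrite tE mulf_neq0 // fmorph_eq0.
Qed.

End TwistedEquations.

(** * Maximal tori *)

Section Tori.

Local Open Scope ring_scope.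
Local Open Scope classical_set_scope.

Variable K : closedFieldType.

Lemma invmx_mul n (A B : 'M[K]_n) : A \in unitmx -> B \in unitmx ->
  invmx (A *m B) = invmx B *m invmx A.
Proof.
move=> Au Bu; have ABu : A *m B \in unitmx by rewrite unitmx_mul Au.
apply: (can_inj (mulKmx ABu)).
by rewrite mulmxV // -mulmxA (mulmxA B) mulmxV // mul1mx mulmxV.
Qed.

Lemma diag_torusP n (x : 'M[K]_n) :
  diag_torus K n x <-> exists2 e : 'rV[K]_n, forall i, e 0 i != 0 & x = diag_mx e.
Proof.
split=> [[xu /diag_mxP[e xe]]|[e e0 ->]].
  exists e => // i; move: xu; rewrite xe unitmxE det_diag unitfE => /prodf_neq0.
  exact.
split; last exact: diag_mx_is_diag.
by rewrite unitmxE det_diag unitfE; apply/prodf_neq0 => i.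
Qed.

Lemma diag_torus_comm n (x y : 'M[K]_n) :
  diag_torus K n x -> diag_torus K n y -> x *m y = y *m x.
Proof. by move=> [_ /diag_mxP[d ->]] [_ /diag_mxP[e ->]]; apply: diag_mxC. Qed.

Lemma diag_torusM n (x y : 'M[K]_n) :
  diag_torus K n x -> diag_torus K n y -> diag_torus K n (x *m y).
Proof.
move=> [xu /diag_mxP[d xd]] [yu /diag_mxP[e ye]]; split.
  by rewrite unitmx_mul xu.
by rewrite xd ye mulmx_diag diag_mx_is_diag.
Qed.

Lemma diag_torusV n (x : 'M[K]_n) : diag_torus K n x -> diag_torus K n (invmx x).
Proof.
move=> /diag_torusP[e e0 ->]; apply/diag_torusP; exists (\row_i (e 0 i)^-1).
  by move=> i; rewrite mxE invr_neq0.
have xu : diag_mx e \in unitmx.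
  by have [] : diag_torus K n (diag_mx e) by apply/diag_torusP; exists e.
apply: (can_inj (mulKmx xu)); rewrite mulmxV // mulmx_diag.
rewrite -[1%:M]diag_const_mx; congr diag_mx.
by apply/rowP => i; rewrite !mxE mulfV.
Qed.

Lemma diag_torus1 n : diag_torus K n 1%:M.
Proof. by split; [rewrite unitmx1 | rewrite -diag_const_mx diag_mx_is_diag]. Qed.

Lemma conj_setP n (g : 'M[K]_n) (A : set 'M[K]_n) (x : 'M[K]_n) : g \in unitmx ->
  conj_set g A x <-> A (invmx g *m x *m g).
Proof.
move=> gu; split=> [[y Ay <-]|Ax].
  by rewrite -!mulmxA mulVmx // mulmx1 !mulmxA mulVmx // mul1mx.
exists (invmx g *m x *m g) => //.
by rewrite -!mulmxA mulmxV // mulmx1 !mulmxA mulmxV // mul1mx.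
Qed.

Lemma conj_setM n (g h : 'M[K]_n) (A : set 'M[K]_n) : g \in unitmx -> h \in unitmx ->
  conj_set g (conj_set h A) = conj_set (g *m h) A.
Proof.
move=> gu hu; apply/seteqP; split=> x; rewrite !conj_setP ?unitmx_mul ?gu // invmx_mul //.
  by rewrite !mulmxA.
by rewrite !mulmxA.
Qed.

Lemma conj_set1 n (A : set 'M[K]_n) : conj_set 1%:M A = A.
Proof.
by apply/seteqP; split=> x; rewrite conj_setP ?unitmx1 // invmx1 mul1mx mulmx1.
Qed.

Definition linear_form n (a : 'M[K]_n) : {mpoly K[n * n]} :=
  \sum_i \sum_j a i j *: 'X_(mxvec_index i j).

Lemma eval_linear_form n (a x : 'M[K]_n) :
  eval_entries (linear_form a) x = \sum_i \sum_j a i j * x i j.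
Proof.
rewrite /eval_entries /linear_form raddf_sum; apply: eq_bigr => i _ /=.
rewrite raddf_sum; apply: eq_bigr => j _ /=.
by rewrite mevalZ mevalXU mxvecE.
Qed.

(** The entries of [g *m x *m h] as polynomials in those of [x]: for
    [g] inverse to [h], those off the diagonal are the equations of a conjugate of
    the diagonal torus. *)
Definition sandwich_form n (g h : 'M[K]_n) (i j : 'I_n) : {mpoly K[n * n]} :=
  linear_form (\matrix_(k, l) (g i k * h l j)).

Lemma eval_sandwich_form n (g h x : 'M[K]_n) i j :
  eval_entries (sandwich_form g h i j) x = (g *m x *m h) i j.
Proof.
rewrite eval_linear_form exchange_big mxE; apply: eq_bigr => l _ /=.
rewrite mxE big_distrl; apply: eq_bigr => k _ /=.
by rewrite mxE mulrAC.
Qed.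

Lemma regular_sandwich n (G : set 'M[K]_n) (g h : 'M[K]_n) i j :
  regular_on G (fun x => (g *m x *m h) i j).
Proof.
exists (sandwich_form g h i j), 0 => x _.
by rewrite eval_sandwich_form expr0 divr1.
Qed.

Lemma torus_conj_diag n (g : 'M[K]_n) : g \in unitmx ->
  torus (conj_set g (diag_torus K n)).
Proof.
move=> gu; have mK (x : 'M[K]_n) : invmx g *m (g *m x *m invmx g) *m g = x.
  by rewrite -!mulmxA mulVmx // mulmx1 !mulmxA mulVmx // mul1mx.
have mVK (x : 'M[K]_n) : g *m (invmx g *m x *m g) *m invmx g = x.
  by rewrite -!mulmxA mulmxV // mulmx1 !mulmxA mulmxV // mul1mx.
split.
  split.
  - by move=> x [y [yu _] <-]; rewrite !unitmx_mul unitmx_inv gu yu.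
  - by exists 1%:M; [exact: diag_torus1 | rewrite mulmx1 mulmxV].
  - move=> x y [x' Tx <-] [y' Ty <-]; exists (x' *m y'); first exact: diag_torusM.
    by rewrite !mulmxA mulmxKV.
  - move=> x [x' Tx <-]; exists (invmx x'); first exact: diag_torusV.
    have [xu _] := Tx.
    by rewrite !invmx_mul ?unitmx_mul ?gu ?unitmx_inv ?xu // invmxK mulmxA.
  - exists [set P | exists i j, i != j /\ P = sandwich_form (invmx g) g i j] => x.
    split=> [[y [yu yd] <-]|[xu xP]].
      split; first by rewrite !unitmx_mul unitmx_inv gu yu.
      move=> P [i [j [ij ->]]]; rewrite eval_sandwich_form mK.
      by move/is_diag_mxP: yd; apply.
    apply/conj_setP => //; split; first by rewrite !unitmx_mul unitmx_inv gu xu.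
    apply/is_diag_mxP => i j ij; rewrite -eval_sandwich_form; apply: xP.
    by exists i, j.
exists n, (fun x => g *m x *m invmx g), (fun x => invmx g *m x *m g); split=> //.
- split=> [x Tx|x y _ _|i j]; first by exists x.
    by rewrite !mulmxA mulmxKV.
  exact: regular_sandwich.
- split=> [x [y Ty <-]|x y _ _|i j]; first by rewrite mK.
    by rewrite !mulmxA mulmxK.
  exact: regular_sandwich.
Qed.

Lemma torus_comm n (T : set 'M[K]_n) : torus T ->
  forall x y, T x -> T y -> x *m y = y *m x.
Proof.
move=> [_ [r [f [f' [[_ fM _] [f'T _ _] _ f'K]]]]] x y Tx Ty.
rewrite -(f'K x Tx) -(f'K y Ty) -!fM; try exact: f'T.
by congr f; apply: diag_torus_comm; exact: f'T.
Qed.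

Section PeriodicField.

Variables (Fq : finFieldType) (iota : {rmorphism Fq -> K}).
Hypothesis algK : integralRange iota.

Local Notation q := #|Fq|.

Lemma frob_periodic_tuple r (a : 'I_r -> K) :
  exists2 k, (0 < k)%N & forall i, a i ^+ (q ^ k) = a i.
Proof.
have aP i : exists k, (0 < k)%N /\ a i ^+ (q ^ k) = a i.
  by have [k ? ?] := integral_frob_periodic algK (a i); exists k.
have [k kE] := choice aP; exists (\prod_i k i)%N.
  by rewrite prodn_gt0 // => i; case: (kE i).
move=> i; have [_ ai] := kE i; apply: (frob_periodic_dvd iota ai).
by rewrite (bigD1 i) // dvdn_mulr.
Qed.

(** An element of the diagonal torus has entries in a finite field, so it satisfies
    [x ^ (q ^ k) = x]; an isomorphism of groups preserves this equation, which is
    separable. *)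
Lemma torus_diagonalizable n (T : set 'M[K]_n) : (0 < n)%N -> torus T ->
  forall x, T x -> diagonalizable x.
Proof.
case: n T => // n T _ [_ [r [f [f' [[_ fM _] [f'T _ _] _ f'K]]]]] x Tx.
have /diag_torusP[a a0 xa] := f'T _ Tx.
have [k k0 aE] := frob_periodic_tuple (fun i => a 0 i).
pose ap m := diag_mx (\row_i a 0 i ^+ m).
have fap m : f (ap m.+1) = x ^+ m.+1.
  elim: m => [|m IH].
    rewrite expr1 -(f'K x Tx) xa; congr (f (diag_mx _)).
    by apply/rowP => i; rewrite mxE expr1.
  rewrite exprS -IH -[in x * _](f'K x Tx) -[_ * _]/(_ *m _) -fM.
  - rewrite xa /ap mulmx_diag; congr (f (diag_mx _)); apply/rowP => i.
    by rewrite !mxE exprS.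
  - exact: f'T.
  - apply/diag_torusP; exists (\row_i a 0 i ^+ m.+1) => // i.
    by rewrite mxE expf_neq0.
have xN : x ^+ (q ^ k) = x.
  have N0 : (0 < q ^ k)%N by rewrite expn_gt0 (ltnW (finNzRing_gt1 Fq)).
  rewrite -[in LHS](prednK N0) -fap prednK // -[RHS](f'K x Tx) xa.
  by congr (f (diag_mx _)); apply/rowP => i; rewrite mxE aE.
have [rs [urs rsE]] := frob_iter_poly iota k0.
apply/diagonalizableP; exists rs => //; rewrite -rsE; apply: mxminpoly_min.
by rewrite rmorphB rmorphXn /= horner_mx_X xN subrr.
Qed.

(** A torus is commutative and lies in the span of finitely many of its elements, so
    diagonalizing these simultaneously diagonalizes all of it. *)
Lemma torus_sub_conj_diag n (T : set 'M[K]_n) : (0 < n)%N -> torus T ->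
  exists2 g, g \in unitmx & T `<=` conj_set g (diag_torus K n).
Proof.
move=> n0 torT; have [[Tunit _ _ _ _] _] := torT.
have [r [b [_ bT bspan]]] := exists_row_free_span (fun v => T (vec_mx v)).
pose As := [seq vec_mx (row i b) | i : 'I_r].
have AsT A : A \in As -> T A by move=> /mapP[i _ ->]; apply: bT.
have [P Pu /allP PA] : codiagonalizable As.
  apply/codiagonalizableP; split=> [A B /AsT TA /AsT TB|A /AsT TA].
    exact: (torus_comm torT).
  exact: (torus_diagonalizable n0 torT).
exists (invmx P); first by rewrite unitmx_inv.
move=> x Tx; apply/conj_setP; first by rewrite unitmx_inv.
rewrite invmxK; split; first by rewrite !unitmx_mul unitmx_inv Pu Tunit.
have /submxP[c xc] : (mxvec x <= b)%MS by apply: bspan; rewrite mxvecK.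
have -> : x = \sum_i c 0 i *: vec_mx (row i b).
  rewrite -[x]mxvecK xc mulmx_sum_row raddf_sum; apply: eq_bigr => i _ /=.
  by rewrite linearZ.
rewrite mulmx_sumr mulmx_suml; apply/is_diag_mxP => i j ij.
rewrite summxE big1 // => k _; rewrite -scalemxAr -scalemxAl mxE.
have Ak : vec_mx (row k b) \in As by apply: map_f; rewrite mem_enum.
by have /(diagonalizable_forP _ Pu) -> := PA _ Ak; rewrite ?mulr0.
Qed.

Lemma commute_diag_torus n (x : 'M[K]_n) :
  (forall t, diag_torus K n t -> x *m t = t *m x) -> is_diag_mx x.
Proof.
move=> xt; apply/is_diag_mxP => i j ij.
have [a a0 a1] := exists_neq01 iota.
pose e : 'rV[K]_n := \row_k (if k == i then a else 1).
have Te : diag_torus K n (diag_mx e).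
  by apply/diag_torusP; exists e => // k; rewrite mxE; case: ifP; rewrite ?oner_neq0.
have /matrixP/(_ i j) := xt _ Te; rewrite mul_mx_diag mul_diag_mx !mxE eqxx.
rewrite -val_eqE eq_sym in ij *; rewrite (negPf ij) mulr1 => /eqP.
rewrite -{1}[x i j]mul1r -subr_eq0 -mulrBl mulf_eq0 subr_eq0 eq_sym (negPf a1).
by move/eqP.
Qed.

(** The diagonal torus is its own centralizer among invertible matrices, so its
    conjugates are maximal among commutative groups; every torus lies in one of
    them. *)
Lemma maximal_torusP n (T : set 'M[K]_n) : (0 < n)%N ->
  maximal_torus T <-> exists2 g, g \in unitmx & T = conj_set g (diag_torus K n).
Proof.
move=> n0; split=> [[torT maxT]|[g gu ->]].
  have [g gu sTg] := torus_sub_conj_diag n0 torT.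
  by exists g => //; apply/esym/maxT => //; apply: torus_conj_diag.
split=> [|T' torT' sT']; first exact: torus_conj_diag.
apply/seteqP; split=> // y Ty; apply/conj_setP => //; split.
  have [[T'u _ _ _ _] _] := torT'.
  by rewrite !unitmx_mul unitmx_inv gu T'u.
apply: commute_diag_torus => t Tt.
have T't : T' (g *m t *m invmx g) by apply: sT'; exists t.
have := torus_comm torT' Ty T't => /(congr1 (fun z => invmx g *m z *m g)).
by rewrite !mulmxA mulVmx // mul1mx mulmxKV // => <-.
Qed.

End PeriodicField.

End Tori.

(** * Frobenius-stable maximal tori and their types *)

Section StableTori.

Local Open Scope ring_scope.
Local Open Scope classical_set_scope.

Variables (Fq : finFieldType) (K : closedFieldType) (iota : {rmorphism Fq -> K}).

Local Notation q := #|Fq|.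
Local Notation F := (frob iota).
Local Notation T0 n := (diag_torus K n).

Lemma perm_mx_diagC n (s : 'S_n) (e : 'rV[K]_n) :
  perm_mx s *m diag_mx e = diag_mx (\row_i e 0 (s i)) *m perm_mx s.
Proof.
rewrite mul_diag_mx mul_mx_diag; apply/matrixP => i j; rewrite !mxE.
by case: eqP => [->|_]; rewrite ?mul1r ?mulr1 // mul0r mulr0.
Qed.

Lemma diag_perm_mxC n (s : 'S_n) (e : 'rV[K]_n) :
  diag_mx e *m perm_mx s = perm_mx s *m diag_mx (\row_i e 0 ((s^-1)%g i)).
Proof.
rewrite perm_mx_diagC; congr (diag_mx _ *m _).
by apply/rowP => i; rewrite !mxE permK.
Qed.

Lemma perm_mx_diag_inj n (s s' : 'S_n) (e e' : 'rV[K]_n) : (forall i, e 0 i != 0) ->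
  perm_mx s *m diag_mx e = perm_mx s' *m diag_mx e' -> s = s' /\ e = e'.
Proof.
move=> e0 /matrixP E; have sE i : s i = s' i.
  have := E i (s i); rewrite !mul_mx_diag !mxE eqxx mul1r.
  case: eqP => [->//|_]; rewrite mul0r => /eqP.
  by rewrite (negPf (e0 _)).
have {sE} ss : s = s' by apply/permP.
split=> //; apply/rowP => i; have := E ((s^-1)%g i) i.
by rewrite !mul_mx_diag !mxE -ss permKV eqxx !mul1r.
Qed.

Lemma conj_perm_mx_sub n (s : 'S_n) : conj_set (perm_mx s) (T0 n) `<=` T0 n.
Proof.
move=> x [y /diag_torusP[e e0 ->] <-]; rewrite perm_mx_diagC mulmxK ?unitmx_perm //.
by apply/diag_torusP; exists (\row_i e 0 (s i)) => // i; rewrite mxE.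
Qed.

Lemma conj_monomial n (s : 'S_n) d : T0 n d ->
  conj_set (perm_mx s *m d) (T0 n) = T0 n.
Proof.
move=> Td; have [du _] := Td; rewrite -conj_setM ?unitmx_perm //.
have -> : conj_set d (T0 n) = T0 n.
  apply/seteqP; split=> x; rewrite conj_setP // => Tx.
    have -> : x = d *m (invmx d *m x *m d) *m invmx d.
      by rewrite -!mulmxA mulmxV // mulmx1 mulKVmx.
    by do 2?apply: diag_torusM => //; exact: diag_torusV.
  by do 2?apply: diag_torusM => //; exact: diag_torusV.
apply/seteqP; split; first exact: conj_perm_mx_sub.
move=> x Tx; apply/conj_setP; first exact: unitmx_perm.
apply: (@conj_perm_mx_sub _ s^-1%g); exists x => //.
have PV : invmx (perm_mx s) = perm_mx s^-1%g :> 'M[K]_n.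
  apply: (can_inj (mulKmx (unitmx_perm K s))).
  by rewrite mulmxV ?unitmx_perm // -perm_mxM mulgV perm_mx1.
by rewrite -PV invmxK.
Qed.

(** If row [i] of [h] had nonzero entries in two columns, then [h t h^-1] would fail to
    be diagonal for a diagonal [t] with distinct entries there. *)
Lemma normalizer_diag_torus n (h : 'M[K]_n) : h \in unitmx ->
    conj_set h (T0 n) = T0 n ->
  exists (s : 'S_n) (e : 'rV[K]_n), (forall i, e 0 i != 0) /\ h = perm_mx s *m diag_mx e.
Proof.
move=> hu hT; have [a a0 a1] := exists_neq01 iota.
have row_uniq i j j' : h i j != 0 -> h i j' != 0 -> j = j'.
  move=> hj hj'; apply/eqP; apply: contraT => jj'.
  pose e : 'rV[K]_n := \row_k (if k == j' then a else 1).
  have Te : T0 n (diag_mx e).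
    by apply/diag_torusP; exists e => // k; rewrite mxE; case: ifP; rewrite ?oner_neq0.
  have : T0 n (h *m diag_mx e *m invmx h) by rewrite -hT; exists (diag_mx e).
  move=> /diag_torusP[e' e'0 /(congr1 (mulmx^~ h))]; rewrite mulmxKV // => /matrixP E.
  have ei k : h i k != 0 -> e 0 k = e' 0 i.
    move=> hk; apply: (mulfI hk); have := E i k.
    by rewrite mul_mx_diag mul_diag_mx !mxE => ->; rewrite mulrC.
  have := ei _ hj; rewrite -(ei _ hj') !mxE eqxx (negPf jj') => /esym/eqP.
  by rewrite (negPf a1).
have col_ex j : exists i, h i j != 0.
  have [//|nh] := pselect (exists i, h i j != 0).
  have /matrixP/(_ j j) := mulVmx hu; rewrite !mxE eqxx big1 => [/esym/eqP|k _].
    by rewrite oner_eq0.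
  have [->|hk] := eqVneq (h k j) 0; first by rewrite mulr0.
  by case: nh; exists k.
have [c cE] := choice col_ex.
have c_inj : injective c.
  by move=> j j' cc; apply: (row_uniq (c j)) => //; rewrite cc.
pose s := ((perm c_inj)^-1)%g.
have cs i : c (s i) = i by rewrite -[c _](permE c_inj) permKV.
exists s, (\row_j h (c j) j); split=> [i|]; first by rewrite mxE.
apply/matrixP => i j; rewrite mul_mx_diag !mxE.
case: eqP => [<-|sj]; first by rewrite cs mul1r.
rewrite mul0r; apply/eqP; apply: contraT => hij; case: sj.
by apply: (row_uniq i) => //; have := cE (s i); rewrite cs.
Qed.

Lemma frobeniusE n (x : 'M[K]_n) : frobenius q x = map_mx F x.
Proof. by []. Qed.

Lemma frobenius_conj_diag n (g : 'M[K]_n) : g \in unitmx -> integralRange iota ->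
  frobenius q @` conj_set g (T0 n) = conj_set (map_mx F g) (T0 n).
Proof.
move=> gu algK; apply/seteqP; split=> x.
  move=> [_ [y /diag_torusP[e e0 ->] <-] <-]; rewrite frobeniusE !map_mxM map_invmx.
  exists (map_mx F (diag_mx e)) => //; rewrite map_diag_mx.
  by apply/diag_torusP; exists (map_mx F e) => // i; rewrite mxE fmorph_eq0.
move=> [y /diag_torusP[e e0 ->] <-].
have eF i : exists b, F b = e 0 i.
  have [[|k] // _ kE] := integral_frob_periodic algK (e 0 i).
  by exists (e 0 i ^+ (q ^ k)); rewrite /frob -exprM -expnSr.
have [b bE] := choice eF.
exists (g *m diag_mx (\row_i b i) *m invmx g).
  exists (diag_mx (\row_i b i)) => //; apply/diag_torusP; exists (\row_i b i) => // i.
  by rewrite mxE -(fmorph_eq0 F) /= bE.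
rewrite frobeniusE !map_mxM map_invmx map_diag_mx; congr (_ *m diag_mx _ *m _).
by apply/rowP => i; rewrite !mxE; exact: bE.
Qed.

(** For a stable torus [g T_0 g^-1] the matrix [g^-1 F(g)] normalizes [T_0], so it is
    monomial; its diagonal factor is removed by a diagonal change of [g]. *)
Lemma stable_maximal_torusP n (T : set 'M[K]_n) : (0 < n)%N -> integralRange iota ->
  stable_maximal_tori K q n T <->
  exists (s : 'S_n) (g : 'M[K]_n),
    [/\ g \in unitmx, map_mx F g = g *m perm_mx s & T = conj_set g (T0 n)].
Proof.
move=> n0 algK; split=> [[/(maximal_torusP algK _ n0)[g gu ->]]|[s [g [gu gF ->]]]].
  rewrite frobenius_conj_diag // => gFT.
  have Fgu : map_mx F g \in unitmx by rewrite map_unitmx.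
  have hu : invmx g *m map_mx F g \in unitmx by rewrite unitmx_mul unitmx_inv gu.
  have [|s [e [e0 hE]]] := normalizer_diag_torus hu.
    by rewrite -conj_setM ?unitmx_inv // gFT conj_setM ?unitmx_inv // mulVmx // conj_set1.
  have Fg : map_mx F g = g *m perm_mx s *m diag_mx e.
    by rewrite -mulmxA -hE mulKVmx.
  have [t t0 tE] := hilbert90_perm iota s^-1%g e0.
  pose d := diag_mx (\row_i t i).
  have Td : T0 n d by apply/diag_torusP; exists (\row_i t i) => // i; rewrite mxE.
  have [du _] := Td.
  exists s, (g *m d); split; first by rewrite unitmx_mul gu.
    rewrite map_mxM Fg -!mulmxA; congr (_ *m _); rewrite map_diag_mx mulmx_diag.
    rewrite perm_mx_diagC; congr (diag_mx _ *m _); apply/rowP => i; rewrite !mxE.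
    by rewrite -tE permK.
  by rewrite -conj_setM // -[in RHS](mul1mx d) -perm_mx1 conj_monomial.
split; first by apply/(maximal_torusP algK) => //; exists g.
rewrite frobenius_conj_diag // gF -conj_setM ?unitmx_perm //.
rewrite -[perm_mx s]mulmx1 conj_monomial //; exact: diag_torus1.
Qed.

Lemma count_cycle_type n (s : 'S_n) k :
  count_mem k (cycle_type s) = n_cycles k s.
Proof.
rewrite /cycle_type count_sort count_map /n_cycles cardE /enum_mem size_filter.
rewrite -!enumT count_filter; apply: eq_count => c /=.
by rewrite !inE andbC.
Qed.

Lemma prod_cycle_type n (s : 'S_n) (f : nat -> nat) :
  (\prod_(k <- cycle_type s) f k = \prod_(c in porbits s) f #|c|)%N.
Proof.
have /permPl perm_s := perm_sort geq [seq #|pred_of_set c| | c <- enum (porbits s)].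
by rewrite (perm_big _ perm_s) big_map big_enum.
Qed.

Lemma cycle_type_conj n (s w : 'S_n) : cycle_type (s ^ w)%g = cycle_type s.
Proof.
rewrite /cycle_type; apply/perm_sortP.
- by move=> a b; apply: leq_total.
- by move=> a b c ba ac; apply: leq_trans ac ba.
- by move=> a b; rewrite andbC => /anti_leq.
rewrite (_ : [seq #|pred_of_set c| | c <- enum (porbits s)] =
    [seq #|pred_of_set c| | c <- [seq w @: pred_of_set c | c <- enum (porbits s)]]).
  apply: perm_map; apply: uniq_perm; rewrite ?enum_uniq //.
    rewrite map_inj_uniq ?enum_uniq //; exact/imset_inj/perm_inj.
  move=> c; rewrite mem_enum porbits_conj; apply/imsetP/mapP => -[b bs ->];
  by exists b; rewrite ?mem_enum // -mem_enum.
by rewrite -map_comp; apply: eq_map => c /=; rewrite card_imset //; apply: perm_inj.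
Qed.

(** Two frames [g] and [g'] of the same stable torus differ by a monomial
    matrix; comparing it with its image under [F] relates the permutations. *)
Lemma frames_of_stable_torus n (g g' : 'M[K]_n) (s s' : 'S_n) (d : 'rV[K]_n) :
    g \in unitmx -> g' \in unitmx ->
    map_mx F g = g *m perm_mx s -> map_mx F g' = g' *m perm_mx s' *m diag_mx d ->
    conj_set g (T0 n) = conj_set g' (T0 n) ->
  exists (w : 'S_n) (e : 'rV[K]_n),
    [/\ forall i, e 0 i != 0, g' = g *m perm_mx w *m diag_mx e, s' = (s ^ w)%g &
        forall i, F (e 0 i) = e 0 ((s'^-1)%g i) * d 0 i].
Proof.
move=> gu g'u gF g'F gg'; pose m := invmx g *m g'.
have mu : m \in unitmx by rewrite unitmx_mul unitmx_inv gu.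
have [|w [e [e0 mE]]] := normalizer_diag_torus mu.
  by rewrite -conj_setM ?unitmx_inv // -gg' conj_setM ?unitmx_inv // mulVmx // conj_set1.
have g'E : g' = g *m perm_mx w *m diag_mx e by rewrite -mulmxA -mE mulKVmx.
move: g'F; rewrite g'E !map_mxM gF map_perm_mx map_diag_mx.
rewrite -(mulmxA g) -perm_mxM -3!mulmxA -[RHS]mulmxA => /(can_inj (mulKmx gu)).
rewrite (mulmxA (diag_mx e)) diag_perm_mxC -mulmxA mulmx_diag mulmxA -perm_mxM => E.
have [|ss /rowP ee] := perm_mx_diag_inj _ E; first by move=> i; rewrite mxE fmorph_eq0.
exists w, e; split=> //; first by rewrite conjgE ss mulKg.
by move=> i; have := ee i; rewrite !mxE.
Qed.

Lemma torus_typeE n (g : 'M[K]_n) (s : 'S_n) : g \in unitmx ->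
    map_mx F g = g *m perm_mx s ->
  torus_type q (conj_set g (T0 n)) = cycle_type s.
Proof.
move=> gu gF; rewrite /torus_type; case: xgetP => [lambda _|]; last first.
  move/(_ (cycle_type s)); case; exists g, s; split=> //.
  by exists 1%:M; [exact: diag_torus1 | rewrite frobeniusE gF mulKmx // mulmx1].
move=> [g' [s' [g'u gg' [d' /diag_torusP[d _ ->] hE] ->]]].
have g'F : map_mx F g' = g' *m perm_mx s' *m diag_mx d.
  by rewrite -mulmxA -hE frobeniusE mulKVmx.
have [w [e [_ _ -> _]]] := frames_of_stable_torus gu g'u gF g'F gg'.
exact: cycle_type_conj.
Qed.

End StableTori.

(** * Counting tori by their frames *)

Section UniformStableTorus.

Local Open Scope ring_scope.
Local Open Scope classical_set_scope.

Variables (Fq : finFieldType) (K : closedFieldType) (iota : {rmorphism Fq -> K}).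
Hypothesis algK : integralRange iota.

Local Notation q := #|Fq|.
Local Notation F := (frob iota).
Local Notation T0 n := (diag_torus K n).

Definition descend m n (M : 'M[K]_(m, n)) : 'M[Fq]_(m, n) :=
  map_mx (fun a => odflt 0 [pick b | iota b == a]) M.

Lemma descendK m n (M : 'M[K]_(m, n)) : map_mx F M = M -> map_mx iota (descend M) = M.
Proof.
move=> /frob_mx_fixed[B ->]; apply/matrixP => i j; rewrite !mxE.
by case: pickP => [b /eqP //|/(_ (B i j))]; rewrite eqxx.
Qed.

Section Frames.

Variables (n : nat) (frame : 'S_n -> 'M[K]_n).
Hypothesis frame_unit : forall s, frame s \in unitmx.
Hypothesis frobenius_frame : forall s, map_mx F (frame s) = frame s *m perm_mx s.

(** The matrices [g] with [F(g) = g P_s] form a torsor under [GL_n(Fq)]; with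
    [frame s] as base point they are indexed by a finite type. *)
Definition twisted_frame (p : 'S_n * 'M[Fq]_n) : 'M[K]_n :=
  map_mx iota p.2 *m frame p.1.

Definition torus_of_frame (p : 'S_n * 'M[Fq]_n) : set 'M[K]_n :=
  conj_set (twisted_frame p) (T0 n).

Lemma twisted_frame_unit p : (twisted_frame p \in unitmx) = (p.2 \in unitmx).
Proof. by rewrite unitmx_mul frame_unit andbT map_unitmx. Qed.

Lemma map_iota_fixed m k (h : 'M[Fq]_(m, k)) : map_mx F (map_mx iota h) = map_mx iota h.
Proof. by apply/matrixP => i j; rewrite !mxE; exact: frob_iota. Qed.

Lemma frobenius_twisted_frame p :
  map_mx F (twisted_frame p) = twisted_frame p *m perm_mx p.1.
Proof. by rewrite map_mxM map_iota_fixed frobenius_frame mulmxA. Qed.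

Lemma twisted_frameK (g : 'M[K]_n) (s : 'S_n) : map_mx F g = g *m perm_mx s ->
  twisted_frame (s, descend (g *m invmx (frame s))) = g.
Proof.
move=> gF; rewrite /twisted_frame descendK /=; first by rewrite mulmxKV.
have Pu := unitmx_perm K s.
rewrite map_mxM map_invmx frobenius_frame gF invmx_mul // -mulmxA.
by rewrite (mulmxA (perm_mx s)) mulmxV // mul1mx.
Qed.

(** The frames of a given torus are the [g0 P_w D] with [w] a permutation and [D] an
    invertible diagonal matrix such that [F(D)] is the matrix [D] with its entries
    permuted by the conjugate of [p.1] under [w]. *)
Lemma card_frames_of_torus p : p.2 \in unitmx ->
  #|[pred p' | (p'.2 \in unitmx) && (torus_of_frame p' == torus_of_frame p)]| =
  (n`! * \prod_(c in porbits p.1) (q ^ #|c| - 1))%N.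
Proof.
case: p => s0 h0 /= h0u.
have [g0 [g0u g0F ->]] : exists g0, [/\ g0 \in unitmx,
    map_mx F g0 = g0 *m perm_mx s0 &
    torus_of_frame (s0, h0) = conj_set g0 (T0 n)].
  exists (twisted_frame (s0, h0)); split=> //; first by rewrite twisted_frame_unit.
  exact: (frobenius_twisted_frame (s0, h0)).
have SP (w : 'S_n) : exists S : seq {ffun 'I_n -> K}, [/\ uniq S,
    size S = (\prod_(c in porbits s0) (q ^ #|c| - 1))%N &
    forall f, f \in S <->
      forall i, f i != 0 /\ f (((s0 ^ w)^-1)%g i) = F (f i)].
  have [S [uS sS] SE] := seq_twisted_units iota ((s0 ^ w)^-1)%g.
  exists S; split=> //; rewrite sS porbitsV.
  exact: (prod_porbits_conj s0 w (fun k => q ^ k - 1)%N).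
have [S SE] := choice SP.
pose fr w (f : {ffun 'I_n -> K}) : 'M[K]_n := g0 *m perm_mx w *m diag_mx (\row_i f i).
pose pr w f := ((s0 ^ w)%g, descend (fr w f *m invmx (frame (s0 ^ w)%g))).
have frF w f : f \in S w -> map_mx F (fr w f) = fr w f *m perm_mx (s0 ^ w)%g.
  case: (SE w) => _ _ -> fS; rewrite /fr map_mxM map_mxM g0F map_perm_mx map_diag_mx.
  rewrite -(mulmxA g0 (perm_mx s0)) -perm_mxM -[RHS]mulmxA diag_perm_mxC mulmxA.
  rewrite -(mulmxA g0 (perm_mx w)) -perm_mxM conjgE mulKVg; congr (_ *m diag_mx _).
  by apply/rowP => i; rewrite !mxE; case: (fS i).
have fr_pr w f : f \in S w -> twisted_frame (pr w f) = fr w f.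
  by move=> /frF; apply: twisted_frameK.
have diagT w f : f \in S w -> T0 n (diag_mx (\row_i f i)).
  case: (SE w) => _ _ -> fS; apply/diag_torusP; exists (\row_i f i) => // i.
  by rewrite mxE; case: (fS i).
have fru w f : f \in S w -> fr w f \in unitmx.
  move=> /diagT[du _]; rewrite unitmx_mul du andbT unitmx_mul unitmx_perm andbT.
  exact: g0u.
pose L := [seq pr w f | w <- enum 'S_n, f <- S w].
have uL : uniq L.
  apply: allpairs_uniq_dep => [|w _|]; first exact: enum_uniq.
    by case: (SE w).
  move=> [w f] [w' f'] /allpairsPdep[w1 [f1 [_ f1S E1]]] /allpairsPdep[w2 [f2 [_ f2S E2]]].
  pose untag (z : {w : 'S_n & {ffun 'I_n -> K}}) := (tag z, tagged z).
  have [ww1 ff1] := congr1 untag E1; have [ww2 ff2] := congr1 untag E2.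
  move: f1S f2S; rewrite -ww1 -ff1 -ww2 -ff2 => fS f'S /= /(congr1 twisted_frame).
  rewrite !fr_pr // /fr -!mulmxA => /(can_inj (mulKmx g0u)) E.
  have [|<- /rowP ff'] := perm_mx_diag_inj _ E.
    by case: (SE w) => _ _ /(_ f)/proj1/(_ fS) fP i; rewrite mxE; case: (fP i).
  by congr existT; apply/ffunP => i; have := ff' i; rewrite !mxE.
set X := [pred p' | _]; have -> : #|X| = #|L|.
  apply: eq_card => -[s h]; rewrite inE /=; apply/andP/allpairsPdep => [[hu /eqP hT]|].
    pose g := twisted_frame (s, h).
    have gu : g \in unitmx by rewrite twisted_frame_unit.
    have gF : map_mx F g = g *m perm_mx s *m diag_mx (const_mx 1).
      by rewrite diag_const_mx mulmx1; apply: (frobenius_twisted_frame (s, h)).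
    have [w [e [e0 gE sE eE]]] := frames_of_stable_torus g0u gu g0F gF (esym hT).
    have eS : [ffun i => e 0 i] \in S w.
      case: (SE w) => _ _ -> i; rewrite !ffunE; split=> //.
      by rewrite eE mxE mulr1 sE.
    exists w, [ffun i => e 0 i]; split=> //; first by rewrite mem_enum.
    have fg : fr w [ffun i => e 0 i] = g.
      by rewrite gE /fr; congr (_ *m diag_mx _); apply/rowP => i; rewrite mxE ffunE.
    rewrite /pr -sE fg; congr (_, _); apply: (@map_mx_inj _ _ iota).
    apply: (can_inj (mulmxK (frame_unit s))).
    rewrite -[RHS]/(twisted_frame (s, _)) twisted_frameK //.
    exact: (frobenius_twisted_frame (s, h)).
  move=> [w [f [_ fS E]]]; split.
    by rewrite -[h]/((s, h).2) -twisted_frame_unit E fr_pr // fru.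
  rewrite E /torus_of_frame fr_pr // /fr -mulmxA -conj_setM ?unitmx_mul ?unitmx_perm //.
    by rewrite conj_monomial //; apply: diagT fS.
  by case: (diagT _ _ fS).
rewrite (card_uniqP uL) size_allpairs_dep.
rewrite (eq_map (g := fun=> (\prod_(c in porbits s0) (q ^ #|c| - 1))%N)); last first.
  by move=> w; case: (SE w).
by rewrite sumnE big_map big_const_seq count_predT -cardE card_Sn iter_addn_0 mulnC.
Qed.

Lemma stable_maximal_tori_image : (0 < n)%N ->
  stable_maximal_tori K q n = torus_of_frame @` [set p | p.2 \in unitmx].
Proof.
move=> n0; apply/seteqP; split=> T.
  move=> /(stable_maximal_torusP _ n0 algK)[s [g [gu gF ->]]].
  exists (s, descend (g *m invmx (frame s))); last by rewrite /torus_of_frame twisted_frameK.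
  have := twisted_frame_unit (s, descend (g *m invmx (frame s))).
  by rewrite twisted_frameK // gu /= => <-.
move=> [p pu <-]; apply/(stable_maximal_torusP _ n0 algK).
exists p.1, (twisted_frame p); split=> //; first by rewrite twisted_frame_unit.
exact: frobenius_twisted_frame.
Qed.

Lemma torus_type_frame p : p.2 \in unitmx ->
  torus_type q (torus_of_frame p) = cycle_type p.1.
Proof.
move=> pu; apply: (torus_typeE (iota := iota)); first by rewrite twisted_frame_unit.
exact: frobenius_twisted_frame.
Qed.

Local Notation x := (q%:R : rat).

Lemma aperiodic_card k : (0 < k)%N -> x ^+ k != 1.
Proof.
move=> k0; rewrite -natrX -[1]/(1%:R) eqr_nat gtn_eqF //.
by rewrite -(exp1n k) ltn_exp2r // finNzRing_gt1.
Qed.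

(** Summing over frames instead of tori, each torus of type [lambda] is counted
    [n! * \prod_k (q ^ lambda_k - 1)] times. *)
Lemma sum_stable_tori (f : seq nat -> rat) : (0 < n)%N ->
  \sum_(T <- fset_set (stable_maximal_tori K q n)) f (torus_type q T) =
  #|[pred h : 'M[Fq]_n | h \in unitmx]|%:R / n`!%:R *
  \sum_(s : 'S_n) f (cycle_type s) *
     cycle_weight (fun k => (x ^+ k - 1)^-1) [set: 'I_n]%SET s.
Proof.
move=> n0; set E := fset_set _.
pose D (lambda : seq nat) := (\prod_(k <- lambda) (q ^ k - 1))%N.
pose H (T : set 'M[K]_n) := f (torus_type q T) / (n`! * D (torus_type q T))%:R.
have D0 lambda : (forall k, k \in lambda -> (0 < k)%N) -> (0 < D lambda)%N.
  move=> l0; rewrite /D big_seq; apply: prodn_cond_gt0 => k /l0 k0.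
  by rewrite subn_gt0 -(exp1n k) ltn_exp2r // finNzRing_gt1.
have Dtype (s : 'S_n) : (0 < D (cycle_type s))%N.
  apply: D0 => k; rewrite mem_sort => /mapP[c]; rewrite mem_enum => /imsetP[i _ ->] ->.
  by rewrite lt0n card_porbit_neq0.
have finE : finite_set (stable_maximal_tori K q n).
  by rewrite stable_maximal_tori_image //; apply: finite_image; apply: finite_finset.
have EP T : T \in E -> exists2 p, p.2 \in unitmx & T = torus_of_frame p.
  rewrite in_fset_set // => /set_mem; rewrite stable_maximal_tori_image // => -[p pu <-].
  by exists p.
transitivity (\sum_(p | p.2 \in unitmx) H (torus_of_frame p)).
  have HE p : p.2 \in unitmx -> H (torus_of_frame p) =
      \sum_(T <- E | torus_of_frame p == T) H T.
    move=> pu; rewrite (eq_bigl (pred1 (torus_of_frame p))); last first.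
      by move=> T; rewrite /= eq_sym.
    rewrite -big_filter filter_pred1_uniq ?fset_uniq ?big_seq1 //.
    rewrite in_fset_set //; apply/mem_set.
    by rewrite stable_maximal_tori_image.
  rewrite (eq_bigr _ HE) (exchange_big_dep predT) //= big_seq [RHS]big_seq.
  apply: eq_bigr => T /EP[p pu ->].
  rewrite (eq_bigl [pred p' | (p'.2 \in unitmx) && (torus_of_frame p' == torus_of_frame p)]) //.
  rewrite sumr_const card_frames_of_torus // /H torus_type_frame //.
  rewrite -(prod_cycle_type p.1 (fun k => q ^ k - 1)%N) -/(D _).
  rewrite -[RHS]mulr_natr mulfVK // pnatr_eq0 -lt0n muln_gt0 fact_gt0 /=.
  exact: Dtype.
rewrite (eq_bigr (fun p => H (torus_of_frame p))) //.
transitivity (\sum_(s : 'S_n) \sum_(h : 'M[Fq]_n | h \in unitmx)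
    f (cycle_type s) / (n`! * D (cycle_type s))%:R).
  rewrite pair_big /=; apply: eq_bigr => p pu; by rewrite /H torus_type_frame.
rewrite big_distrr /=; apply: eq_bigr => s _.
have -> : cycle_weight (fun k => (x ^+ k - 1)^-1)
    [set: 'I_n]%SET s = (D (cycle_type s))%:R^-1.
  rewrite /D prod_cycle_type natr_prod -prodfV; apply: eq_big => [c|c].
    by rewrite subsetT andbT.
  rewrite subsetT andbT => /imsetP[i _ ->]; rewrite natrB ?natrX //.
  by rewrite expn_gt0 (ltnW (finNzRing_gt1 Fq)).
have -> : #|[pred h : 'M[Fq]_n | h \in unitmx]| = #|@unitmx Fq n|.
  by apply: eq_card => h; rewrite inE.
by rewrite sumr_const -[LHS]mulr_natl natrM invfM; ring.
Qed.

End Frames.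

End UniformStableTorus.

(** * The expectation *)

Local Open Scope classical_set_scope.
Local Open Scope ring_scope.

Theorem theorem3p6 (q : nat) (Fq : finFieldType) (hq : #|Fq| = q)
    (K : closedFieldType) (iota : {rmorphism Fq -> K})
    (algK : integralRange iota) (n : nat) (hn : (2 <= n)%N) :
  uniform_expectation (stable_maximal_tori K q n)
    (fun T => (n_reducible_dim2 q T)%:R - (n_irreducible_dim2 q T)%:R) =
  1 / q%:R *
    (((1 - 1 / q%:R ^+ (n - 1)) * (1 - 1 / q%:R ^+ n)) /
     ((1 - 1 / q%:R) * (1 - 1 / q%:R ^+ 2))).
Proof.
subst q; have n0 : (0 < n)%N := ltnW hn.
have frameP (s : 'S_n) : exists g : 'M[K]_n,
    g \in unitmx /\ map_mx (frob iota) g = g *m perm_mx s.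
  by have [g ? ?] := lang_perm_mx iota s; exists g.
have [frame frameE] := choice frameP.
have sumE := sum_stable_tori algK (fun s => (frameE s).1) (fun s => (frameE s).2) _ n0.
rewrite /uniform_expectation.
rewrite (sumE (fun lambda => 'C(count_mem 1%N lambda, 2)%:R - (count_mem 2 lambda)%:R)).
have -> : (#|` fset_set (stable_maximal_tori K #|Fq| n)|)%:R =
    \sum_(T <- fset_set (stable_maximal_tori K #|Fq| n)) (1 : rat).
  by rewrite big_const_seq count_predT iter_addr addr0.
have cardE : \sum_(T <- fset_set (stable_maximal_tori K #|Fq| n)) (1 : rat) = _ :=
  sumE (fun=> 1).
rewrite cardE -mean_pairs_cycle_weight //; first last.
- by rewrite pnatr_eq0 -lt0n (ltnW (finNzRing_gt1 Fq)).
- by rewrite pnatr_eq0 -lt0n fact_gt0.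
- exact: aperiodic_card.
rewrite -mulf_div divff ?mul1r; last first.
  rewrite mulf_neq0 ?invr_neq0 // pnatr_eq0 -lt0n ?fact_gt0 //.
  by apply/card_gt0P; exists 1%:M; rewrite inE unitmx1.
congr (_ / _); apply: eq_bigr => s _; last by rewrite mul1r.
by rewrite !count_cycle_type.
Qed.
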